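(* Let $\mathfrak{g}\in\mathbb{H}$ and $\mathfrak{h}\in\mathbb{H}_d$, and let $E$ be an $F_{\mathfrak{h}\mathfrak{g}}$-set. For $0<\delta<1$ put $C(\delta)=\int_\delta^1\frac{\mathfrak{g}(u)}{u^2}\,du$. If $h\in\mathbb{H}$ satisfies $$\sum_{k}\sqrt{\frac{\mathfrak{h}^2(2^{-k})\,C(2^{-k})}{h(2^{-k})}}<\infty,$$ then $\mathcal{H}^h(E)>0$.
   Context: $\mathbb{H}$ is the class of non-decreasing, right continuous functions $h:[0,\infty)\to[0,\infty)$ with $h(0)=0$; $\mathbb{H}_d=\{h\in\mathbb{H}: h(2x)\le C h(x)\text{ for all }x \text{ and some } C>0\}$ (doubling). For $h\in\mathbb{H}$, $F\subseteq\mathbb{R}^n$, $\delta>0$: $\mathcal{H}^h_\delta(F)=\inf\{\sum_i h(\mathrm{diam}(F_i)): F\subseteq\bigcup_i F_i,\ \mathrm{diam}(F_i)<\delta\}$ and $\mathcal{H}^h(F)=\sup_{\delta>0}\mathcal{H}^h_\delta(F)$. $\mathbb{S}$ is the unit circle. Given $\mathfrak{h},\mathfrak{g}\in\mathbb{H}$, a set $E\subseteq\mathbb{R}^2$ is an $F_{\mathfrak{h}\mathfrak{g}}$-set if there is $L\subseteq\mathbb{S}$ with $\mathcal{H}^{\mathfrak{g}}(L)>0$ and a number $\delta_E>0$ such that for each $e\in L$ there is a line segment $\ell_e$ in direction $e$ with $\mathcal{H}^{\mathfrak{h}}_\delta(\ell_e\cap E)>1$ for all $0<\delta<\delta_E$.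 *)

(* Defs.v *)
From Stdlib Require Import Reals Lra ClassicalEpsilon.
Open Scope R_scope.

Definition pt := (R * R)%type.
Definition dist2 (p q : pt) : R :=
  sqrt ((fst p - fst q) ^ 2 + (snd p - snd q) ^ 2).

Definition inH (h : R -> R) : Prop :=
  h 0 = 0 /\
  (forall x, 0 <= x -> 0 <= h x) /\
  (forall x y, 0 <= x -> x <= y -> h x <= h y) /\
  (forall x, 0 <= x -> forall eps, 0 < eps ->
     exists d, 0 < d /\ forall y, x <= y < x + d -> Rabs (h y - h x) < eps).

Definition inHd (h : R -> R) : Prop :=
  inH h /\ exists C, 0 < C /\ forall x, 0 <= x -> h (2 * x) <= C * h x.

(* Diameter: sup of pairwise distances (0 for the empty set) *)
Definition dists (F : pt -> Prop) (r : R) : Prop :=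
  r = 0 \/ exists x y, F x /\ F y /\ r = dist2 x y.
Definition diam (F : pt -> Prop) : R :=
  epsilon (inhabits 0) (fun d => is_lub (dists F) d).
(* diam F exists (F bounded) and is < delta *)
Definition diam_lt (F : pt -> Prop) (delta : R) : Prop :=
  exists d, is_lub (dists F) d /\ d < delta.

Definition delta_cover (delta : R) (A : pt -> Prop) (F : nat -> pt -> Prop) : Prop :=
  (forall x, A x -> exists i, F i x) /\ (forall i, diam_lt (F i) delta).

(* sum_{i>=0} a i >= eta, in [0,+oo] (a nonnegative) *)
Definition series_ge (a : nat -> R) (eta : R) : Prop :=
  forall t, t < eta -> exists N, t < sum_f_R0 a N.

(* H^h_delta(A) > c, i.e. the infimum over delta-covers exceeds c *)
Definition Hdelta_gt (h : R -> R) (delta : R) (A : pt -> Prop) (c : R) : Prop :=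
  exists eta, c < eta /\
    forall F, delta_cover delta A F -> series_ge (fun i => h (diam (F i))) eta.

(* H^h(A) > c, with H^h = sup_{delta>0} H^h_delta *)
Definition Haus_gt (h : R -> R) (A : pt -> Prop) (c : R) : Prop :=
  exists delta, 0 < delta /\ Hdelta_gt h delta A c.

Definition circle (e : pt) : Prop := fst e ^ 2 + snd e ^ 2 = 1.

Definition segment_dir (e : pt) (l : pt -> Prop) : Prop :=
  exists (a : pt) (len : R), 0 < len /\
    forall p, l p <-> exists t, 0 <= t <= len /\
      p = (fst a + t * fst e, snd a + t * snd e).

Definition F_set (hf gf : R -> R) (E : pt -> Prop) : Prop :=
  exists L : pt -> Prop,
    (forall e, L e -> circle e) /\ Haus_gt gf L 0 /\
    exists deltaE, 0 < deltaE /\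
      forall e, L e -> exists l, segment_dir e l /\
        forall delta, 0 < delta < deltaE -> Hdelta_gt hf delta (fun p => l p /\ E p) 1.

(* C(delta) = int_delta^1 g(u)/u^2 du (Riemann integral; exists for monotone g) *)
Definition Cint (g : R -> R) (delta : R) : R :=
  epsilon (inhabits 0) (fun I => exists pr : Riemann_integrable (fun u => g u / u ^ 2) delta 1,
                                   RiemannInt pr = I).

(* the summability condition, over k >= 1 (where 0 < 2^-k < 1) *)
Definition sum_condition (hf gf h : R -> R) : Prop :=
  (forall k : nat, (1 <= k)%nat -> 0 < h (/ 2 ^ k)) /\
  exists l, Un_cv (fun N => sum_f_R0 (fun k =>
      let x := / 2 ^ (S k) in sqrt (hf x ^ 2 * Cint gf x / h x)) N) l.

(* Main.v *)
(** The relevant part of a cover of [E] lives, for each direction [e], at some scale [2^-k]: since the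
    square roots [a_k] in the summability condition have small tails, the segment [l_e] meets more than
    [a_k / hf (2^-k)] of the grid squares of side about [2^-k] that the cover touches, for some [k].
    For fixed [k], a Frostman measure on the set of these directions and Cordoba's Cauchy-Schwarz
    argument bound the [gf]-content of that set by a multiple of the number of squares times
    [hf (2^-k)^2 C(2^-k) / a_k^2], that is, by the [h]-cost of the squares. Summing over [k], the
    [gf]-content of the directions is at most a multiple of the [h]-cost of the cover.

    The argument is discrete: only finitely many squares are involved at each scale, the Frostman
    measure is a finite weighted set of directions obtained from a quadtree, and neither [E] nor [L] has
    to be measurable. *)
Require Import Defs.
From Stdlib Require Import Reals Lra Lia ZArith List ClassicalEpsilon Cantor.
From Coquelicot Require Import Coquelicot.
Import ListNotations.
Open Scope R_scope.

(** * Finite sums over lists, Cauchy-Schwarz and indicators *)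

Definition lsum {A} (f : A -> R) (l : list A) : R :=
  fold_right (fun a s => f a + s) 0 l.

Lemma lsum_app {A} (f : A -> R) l1 l2 : lsum f (l1 ++ l2) = lsum f l1 + lsum f l2.
Proof. induction l1 as [|a l IH]; simpl; [|rewrite IH]; lra. Qed.

Lemma lsum_le {A} (f g : A -> R) l :
  (forall x, In x l -> f x <= g x) -> lsum f l <= lsum g l.
Proof.
  induction l as [|a l IH]; simpl; intros H; [lra|].
  pose proof (H a (or_introl eq_refl)).
  specialize (IH (fun x Hx => H x (or_intror Hx))). lra.
Qed.

Lemma lsum_ext {A} (f g : A -> R) l :
  (forall x, In x l -> f x = g x) -> lsum f l = lsum g l.
Proof. intros H; apply Rle_antisym; apply lsum_le; intros x Hx; rewrite H; auto; lra. Qed.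

Lemma lsum_const {A} c (l : list A) : lsum (fun _ => c) l = INR (length l) * c.
Proof. induction l as [|a l IH]; [simpl; lra|]. cbn [lsum fold_right length] in *.
  rewrite S_INR. unfold lsum in IH. rewrite IH. lra. Qed.

Lemma lsum_ge0 {A} (f : A -> R) l : (forall x, In x l -> 0 <= f x) -> 0 <= lsum f l.
Proof.
  intros H. replace 0 with (lsum (fun _ : A => 0) l) by (rewrite lsum_const; lra).
  now apply lsum_le.
Qed.

Lemma lsum_eq0 {A} (f : A -> R) l : (forall x, In x l -> f x = 0) -> lsum f l = 0.
Proof.
  intros H. rewrite (lsum_ext f (fun _ => 0)) by exact H. rewrite lsum_const; lra.
Qed.

Lemma lsum_scal {A} c (f : A -> R) l : lsum (fun x => c * f x) l = c * lsum f l.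
Proof. induction l as [|a l IH]; simpl; [|rewrite IH]; lra. Qed.

Lemma lsum_plus {A} (f g : A -> R) l : lsum (fun x => f x + g x) l = lsum f l + lsum g l.
Proof. induction l as [|a l IH]; simpl; [|rewrite IH]; lra. Qed.

Lemma lsum_map {A B} (f : B -> R) (u : A -> B) l : lsum f (map u l) = lsum (fun x => f (u x)) l.
Proof. induction l as [|a l IH]; simpl; [|rewrite IH]; lra. Qed.

Lemma lsum_flat_map {A B} (f : B -> R) (u : A -> list B) l :
  lsum f (flat_map u l) = lsum (fun x => lsum f (u x)) l.
Proof. induction l as [|a l IH]; simpl; [|rewrite lsum_app, IH]; lra. Qed.

Lemma length_flat_map_const {A B} (f : A -> list B) n l :
  (forall x, length (f x) = n) -> length (flat_map f l) = (n * length l)%nat.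
Proof. intros H. induction l as [|x l IH]; simpl; [lia|]. rewrite length_app, H, IH. lia. Qed.

Lemma lsum_swap {A B} (f : A -> B -> R) l l' :
  lsum (fun x => lsum (fun y => f x y) l') l = lsum (fun y => lsum (fun x => f x y) l) l'.
Proof.
  induction l as [|a l IH]; simpl.
  - rewrite lsum_eq0; auto.
  - rewrite IH, <- lsum_plus. reflexivity.
Qed.

Lemma lsum_incl {A} (f : A -> R) l l' :
  (forall x, In x l' -> 0 <= f x) -> NoDup l -> incl l l' -> lsum f l <= lsum f l'.
Proof.
  intros Hf Hl. revert l' Hf. induction Hl as [|a l Ha Hl IH]; intros l' Hf Hi; simpl.
  - now apply lsum_ge0.
  - destruct (in_split a l' (Hi a (or_introl eq_refl))) as (l1 & l2 & ->).
    rewrite lsum_app; simpl.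
    enough (lsum f l <= lsum f (l1 ++ l2)) by (rewrite lsum_app in *; lra).
    apply IH.
    + intros x Hx. apply Hf. rewrite in_app_iff in *; simpl; tauto.
    + intros x Hx. specialize (Hi x (or_intror Hx)).
      rewrite in_app_iff in *; simpl in *. destruct Hi as [|[->|]]; tauto.
Qed.

Lemma lsum_cauchy {A} (f : A -> R) l :
  (lsum f l) ^ 2 <= INR (length l) * lsum (fun x => f x ^ 2) l.
Proof.
  induction l as [|a l IH]; [simpl; lra|].
  cbn [length lsum fold_right]. fold (lsum f l) (lsum (fun x => f x ^ 2) l).
  set (s := lsum f l) in *. set (q := lsum (fun x => f x ^ 2) l) in *.
  assert (0 <= q) by (apply lsum_ge0; intros; apply pow2_ge_0).
  rewrite S_INR. pose proof (pos_INR (length l)) as Hn.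
  set (n := INR (length l)) in *.
  destruct (Req_dec n 0) as [E|E].
  - rewrite E in *. assert (s = 0) by nra. nra.
  (* The cross term of the expanded square; multiplied by [n], the bound follows from
     [0 <= (n * f a - s) ^ 2] and the induction hypothesis [s ^ 2 <= n * q]. *)
  - enough (2 * f a * s <= f a ^ 2 * n + q) by nra.
    assert (0 < n) by lra. apply Rmult_le_reg_l with n; [lra|].
    pose proof (pow2_ge_0 (n * f a - s)). nra.
Qed.

Definition indic (P : Prop) : R := if excluded_middle_informative P then 1 else 0.

Lemma indic_true P : P -> indic P = 1.
Proof. intros; unfold indic; destruct excluded_middle_informative; tauto. Qed.

Lemma indic_false P : ~ P -> indic P = 0.
Proof. intros; unfold indic; destruct excluded_middle_informative; tauto. Qed.

Lemma indic_01 P : 0 <= indic P <= 1.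
Proof. unfold indic; destruct excluded_middle_informative; lra. Qed.

Lemma lsum_indic_filter {A} (P : A -> Prop) l :
  lsum (fun x => indic (P x)) l =
  INR (length (filter (fun x => if excluded_middle_informative (P x) then true else false) l)).
Proof.
  induction l as [|a l IH]; [reflexivity|].
  cbn [lsum fold_right filter]. fold (lsum (fun x => indic (P x)) l). rewrite IH. unfold indic.
  destruct excluded_middle_informative; [cbn [length]; rewrite S_INR|]; lra.
Qed.

(** * Dyadic scales and grid squares *)

Lemma two_pow_gt0 n : 0 < 2 ^ n.
Proof. apply pow_lt; lra. Qed.

Lemma inv2_pos n : 0 < / 2 ^ n.
Proof. apply Rinv_0_lt_compat, two_pow_gt0. Qed.

Lemma inv2_S n : / 2 ^ (S n) = / 2 ^ n / 2.
Proof. pose proof (two_pow_gt0 n). simpl. field. lra. Qed.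

Lemma inv2_le n n' : (n <= n')%nat -> / 2 ^ n' <= / 2 ^ n.
Proof. intros. apply Rinv_le_contravar; [apply two_pow_gt0|apply Rle_pow; [lra|lia]]. Qed.

Lemma inv2_small x : 0 < x -> exists n, / 2 ^ n < x.
Proof.
  intros Hx. destruct (pow_lt_1_zero (/2) ltac:(rewrite Rabs_pos_eq; lra) x Hx) as [n Hn].
  exists n. specialize (Hn n (le_n _)). rewrite pow_inv in Hn.
  rewrite Rabs_pos_eq in Hn; [exact Hn|]. left; apply inv2_pos.
Qed.

(* The half-open grid square of side [2^-(n+1)] containing [p]; its diameter is at most [2^-n]. *)
Definition cell (n : nat) (p : pt) : Z * Z :=
  (Int_part (2 ^ S n * fst p), Int_part (2 ^ S n * snd p)).

Lemma Int_part_bounds x : IZR (Int_part x) <= x < IZR (Int_part x) + 1.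
Proof. destruct (base_Int_part x); lra. Qed.

(** Floors nest under halving, also for negative numbers, since division in [Z] rounds down; this
    makes the dyadic grid a quadtree. *)
Lemma Int_part_half y : Int_part y = (Int_part (2 * y) / 2)%Z.
Proof.
  symmetry. apply Int_part_spec.
  pose proof (Int_part_bounds (2 * y)) as H. set (z := Int_part (2 * y)) in *.
  pose proof (Z.div_mod z 2 ltac:(lia)) as E. pose proof (Z.mod_pos_bound z 2 ltac:(lia)) as B.
  assert (IZR z = 2 * IZR (z / 2) + IZR (z mod 2)) as E' by
    (rewrite <- mult_IZR, <- plus_IZR; f_equal; lia).
  assert (0 <= IZR (z mod 2) <= 1) by (split; apply IZR_le; lia). lra.
Qed.

Lemma Int_part_close x y K :
  Rabs (x - y) <= IZR K -> (Z.abs (Int_part x - Int_part y) <= K)%Z.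
Proof.
  intros H. apply Rabs_le_between in H.
  pose proof (Int_part_bounds x). pose proof (Int_part_bounds y).
  assert (IZR (Int_part x) < IZR (Int_part y + K + 1)) by (rewrite !plus_IZR; lra).
  assert (IZR (Int_part y) < IZR (Int_part x + K + 1)) by (rewrite !plus_IZR; lra).
  apply lt_IZR in H2. apply lt_IZR in H3. lia.
Qed.

Lemma cell_parent n p : cell n p = ((fst (cell (S n) p) / 2)%Z, (snd (cell (S n) p) / 2)%Z).
Proof.
  unfold cell; cbn [fst snd]. f_equal;
  rewrite Int_part_half; f_equal; f_equal; simpl; ring.
Qed.

Lemma cell_coarsen n n' p q : (n <= n')%nat -> cell n' p = cell n' q -> cell n p = cell n q.
Proof.
  induction 1 as [|n' _ IH]; [tauto|]. intros E. apply IH. rewrite !(cell_parent n'), E. reflexivity.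
Qed.

Definition children (c : Z * Z) : list (Z * Z) :=
  [(2 * fst c, 2 * snd c); (2 * fst c + 1, 2 * snd c);
   (2 * fst c, 2 * snd c + 1); (2 * fst c + 1, 2 * snd c + 1)]%Z.

Lemma children_NoDup c : NoDup (children c).
Proof.
  unfold children. repeat constructor; simpl; intuition;
  repeat match goal with H : (_, _) = (_, _) |- _ => injection H; clear H; intros end; lia.
Qed.

Lemma in_children n p c : In (cell (S n) p) (children c) <-> cell n p = c.
Proof.
  rewrite (cell_parent n). destruct (cell (S n) p) as [x y], c as [a b]. unfold children; cbn [In fst snd].
  pose proof (Z.div_mod x 2 ltac:(lia)). pose proof (Z.mod_pos_bound x 2 ltac:(lia)).
  pose proof (Z.div_mod y 2 ltac:(lia)). pose proof (Z.mod_pos_bound y 2 ltac:(lia)).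
  split.
  - intros H3. repeat destruct H3 as [H3|H3]; try tauto;
    apply pair_equal_spec in H3 as [? ?]; f_equal; lia.
  - intros H3. apply pair_equal_spec in H3 as [? ?].
    assert (x = 2 * a \/ x = 2 * a + 1)%Z as [->| ->] by lia;
    assert (y = 2 * b \/ y = 2 * b + 1)%Z as [->| ->] by lia; tauto.
Qed.

Lemma abs_coord_le_dist2 p q :
  Rabs (fst p - fst q) <= dist2 p q /\ Rabs (snd p - snd q) <= dist2 p q.
Proof.
  unfold dist2. split; rewrite <- sqrt_Rsqr_abs; apply sqrt_le_1_alt; unfold Rsqr;
  pose proof (pow2_ge_0 (fst p - fst q)); pose proof (pow2_ge_0 (snd p - snd q)); nra.
Qed.

Lemma cell_dist n p q : cell n p = cell n q -> dist2 p q <= / 2 ^ n.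
Proof.
  intros E. apply pair_equal_spec in E as [E1 E2].
  pose proof (Int_part_bounds (2 ^ S n * fst p)). pose proof (Int_part_bounds (2 ^ S n * fst q)).
  pose proof (Int_part_bounds (2 ^ S n * snd p)). pose proof (Int_part_bounds (2 ^ S n * snd q)).
  cbn [fst snd] in *. rewrite E1 in *. rewrite E2 in *. pose proof (two_pow_gt0 (S n)).
  assert (forall a b z, z <= 2 ^ S n * a < z + 1 -> z <= 2 ^ S n * b < z + 1 ->
          (a - b) ^ 2 <= (/ 2 ^ S n) ^ 2) as K.
  { intros a b z Ha Hb. apply pow_maj_Rabs.
    apply Rabs_le. split; apply Rmult_le_reg_l with (2 ^ S n); auto;
    [replace (2 ^ S n * - / 2 ^ S n) with (-1) by (field; lra)
    |replace (2 ^ S n * / 2 ^ S n) with 1 by (field; lra)]; lra. }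
  pose proof (inv2_pos n).
  rewrite <- (sqrt_pow2 (/ 2 ^ n)) by lra. unfold dist2. apply sqrt_le_1_alt.
  rewrite inv2_S in K.
  pose proof (K _ _ _ H H0). pose proof (K _ _ _ H1 H2). nra.
Qed.

(** A sup-norm ball of grid squares: it turns a distance bound of [K] sides into membership in a
    list of known length. *)
Definition box (c : Z * Z) (K : nat) : list (Z * Z) :=
  let r z := map (fun i => z - Z.of_nat K + Z.of_nat i)%Z (seq 0 (2 * K + 1)) in
  list_prod (r (fst c)) (r (snd c)).

Lemma box_length c K : length (box c K) = ((2 * K + 1) ^ 2)%nat.
Proof. unfold box. rewrite length_prod, !length_map, !length_seq. simpl; lia. Qed.

Lemma in_box c K d :
  (Z.abs (fst d - fst c) <= Z.of_nat K)%Z -> (Z.abs (snd d - snd c) <= Z.of_nat K)%Z ->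
  In d (box c K).
Proof.
  destruct d as [x y]; cbn [fst snd]; intros Hx Hy. apply in_prod; apply in_map_iff;
  [exists (Z.to_nat (x - fst c + Z.of_nat K)) | exists (Z.to_nat (y - snd c + Z.of_nat K))];
  rewrite in_seq; lia.
Qed.

Lemma cell_in_box n p q K :
  2 ^ S n * dist2 p q <= INR K -> In (cell n p) (box (cell n q) K).
Proof.
  intros H. destruct (abs_coord_le_dist2 p q) as [H1 H2]. pose proof (two_pow_gt0 (S n)).
  rewrite INR_IZR_INZ in H.
  apply in_box; apply Int_part_close;
  rewrite <- Rmult_minus_distr_l, Rabs_mult, (Rabs_pos_eq (2 ^ S n)) by lra;
  eapply Rle_trans; try exact H; apply Rmult_le_compat_l; lra.
Qed.

(** * A discrete Frostman lemma *)

Definition total (W : list (pt * R)) : R := lsum snd W.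
Definition mass (n : nat) (c : Z * Z) (W : list (pt * R)) : R :=
  lsum (fun pw => indic (cell n (fst pw) = c) * snd pw) W.
Definition cost (gf : R -> R) (cov : list (nat * (Z * Z))) : R :=
  lsum (fun nc => gf (/ 2 ^ fst nc)) cov.

Lemma total_app W1 W2 : total (W1 ++ W2) = total W1 + total W2.
Proof. apply lsum_app. Qed.

Lemma mass_app n c W1 W2 : mass n c (W1 ++ W2) = mass n c W1 + mass n c W2.
Proof. apply lsum_app. Qed.

Lemma mass_eq0 n c W : (forall pw, In pw W -> cell n (fst pw) <> c) -> mass n c W = 0.
Proof. intros H. apply lsum_eq0. intros pw Hp. rewrite indic_false by auto. ring. Qed.

Lemma mass_le_total n c W : (forall pw, In pw W -> 0 <= snd pw) -> mass n c W <= total W.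
Proof.
  intros H. apply lsum_le. intros pw Hp. specialize (H pw Hp).
  pose proof (indic_01 (cell n (fst pw) = c)). nra.
Qed.

(** After exchanging the two sums, every selected point is counted in at least one square of
    [cs]. *)
Lemma selected_mass_le n (P : pt -> Prop) W cs B :
  (forall pw, In pw W -> 0 <= snd pw) ->
  (forall pw, In pw W -> P (fst pw) -> In (cell n (fst pw)) cs) ->
  (forall c, mass n c W <= B) ->
  lsum (fun pw => indic (P (fst pw)) * snd pw) W <= INR (length cs) * B.
Proof.
  intros Hw Hc HB. rewrite <- lsum_const.
  apply Rle_trans with (lsum (fun c => mass n c W) cs); [|apply lsum_le; auto].
  unfold mass. rewrite lsum_swap. apply lsum_le. intros pw Hp. specialize (Hw pw Hp).
  destruct (excluded_middle_informative (P (fst pw))) as [H|H].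
  - rewrite indic_true by exact H.
    destruct (in_split _ _ (Hc pw Hp H)) as (l1 & l2 & ->).
    rewrite lsum_app; simpl. rewrite indic_true by reflexivity.
    assert (forall l, 0 <= lsum (fun c => indic (cell n (fst pw) = c) * snd pw) l) as K.
    { intros l. apply lsum_ge0. intros c _. pose proof (indic_01 (cell n (fst pw) = c)). nra. }
    pose proof (K l1). pose proof (K l2). lra.
  - rewrite indic_false, Rmult_0_l by exact H. apply lsum_ge0. intros c _.
    pose proof (indic_01 (cell n (fst pw) = c)). nra.
Qed.

(* [W] is a measure on [D], within the level-[n] squares [cs], that obeys the Frostman condition at
   all levels from [n] to [k]; the equality between its mass and the cost of the cover [cov] is the
   duality that makes the bound on the mass a bound on the content. *)
Definition frostman (gf : R -> R) (D : pt -> Prop) (n k : nat) (cs : list (Z * Z))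
    (W : list (pt * R)) (cov : list (nat * (Z * Z))) : Prop :=
  (forall pw, In pw W -> D (fst pw) /\ In (cell n (fst pw)) cs /\ 0 <= snd pw) /\
  (forall n' c, (n <= n' <= k)%nat -> mass n' c W <= gf (/ 2 ^ n')) /\
  (forall nc, In nc cov -> (n <= fst nc <= k)%nat) /\
  (forall p, D p -> In (cell n p) cs -> exists n', In (n', cell n' p) cov) /\
  cost gf cov = total W.

(** A square of level at least [n] lies inside a single level-[n] square, so it gets mass from only
    one of the distinct squares of [cs]. Measures and covers can thus be concatenated without loss
    in the Frostman bounds. *)
Lemma frostman_union gf D n k cs :
  (forall n', 0 <= gf (/ 2 ^ n')) -> NoDup cs ->
  (forall c, In c cs -> exists W cov, frostman gf D n k [c] W cov) ->
  exists W cov, frostman gf D n k cs W cov.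
Proof.
  intros gf_pos. induction 1 as [|c cs Hc _ IH]; intros H.
  - exists [], []. repeat split; simpl; try tauto. intros n' c _. apply gf_pos.
  - destruct (H c (or_introl eq_refl)) as (W1 & v1 & A1 & B1 & C1 & D1 & E1).
    destruct IH as (W2 & v2 & A2 & B2 & C2 & D2 & E2); [intros; apply H; now right|].
    exists (W1 ++ W2), (v1 ++ v2). split; [|split; [|split; [|split]]].
    + intros pw Hp. apply in_app_iff in Hp as [Hp|Hp].
      * destruct (A1 pw Hp) as (? & [->|[]] & ?). simpl; auto.
      * destruct (A2 pw Hp) as (? & ? & ?). simpl; auto.
    + intros n' c' Hn. rewrite mass_app.
      destruct (excluded_middle_informative (exists pw, In pw W1 /\ cell n' (fst pw) = c'))
        as [(pw & Hp & Hpc)|Hno].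
      * rewrite (mass_eq0 n' c' W2); [specialize (B1 n' c' Hn); lra|].
        intros qw Hq Hqc. apply Hc.
        destruct (A1 pw Hp) as (_ & [->|[]] & _). destruct (A2 qw Hq) as (_ & Hq' & _).
        rewrite (cell_coarsen n n' (fst pw) (fst qw)); [exact Hq'|lia|congruence].
      * rewrite (mass_eq0 n' c' W1); [specialize (B2 n' c' Hn); lra|].
        intros qw Hq Hqc. apply Hno. eauto.
    + intros nc Hi. apply in_app_iff in Hi as [?|?]; auto.
    + intros p Hp [Hi|Hi].
      * destruct (D1 p Hp (or_introl Hi)) as [n' ?]. exists n'. apply in_app_iff; auto.
      * destruct (D2 p Hp Hi) as [n' ?]. exists n'. apply in_app_iff; auto.
    + unfold cost in *. rewrite lsum_app, total_app. lra.
Qed.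

(** Induction from the finest level upwards: the measures of the four children are joined and, if
    the total exceeds [gf (/ 2 ^ n)], scaled down to that mass while the cover becomes the single
    square [c]. Either way mass and cost stay equal. *)
Lemma frostman_cell gf D d n c :
  (forall n', 0 <= gf (/ 2 ^ n')) -> exists W cov, frostman gf D n (n + d) [c] W cov.
Proof.
  intros gf_pos. revert n c. induction d as [|d IH]; intros n c.
  - destruct (excluded_middle_informative (exists p, D p /\ cell n p = c)) as [(p & Hp & Hc)|Hno].
    + exists [(p, gf (/ 2 ^ n))], [(n, c)]. split; [|split; [|split; [|split]]].
      * intros pw [<-|[]]; simpl; auto.
      * intros n' c' Hn. assert (n' = n) as -> by lia. unfold mass; simpl.
        pose proof (gf_pos n). pose proof (indic_01 (cell n p = c')). nra.
      * intros nc [<-|[]]; simpl; lia.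
      * intros q Hq [->|[]]. exists n. now left.
      * reflexivity.
    + exists [], []. repeat split; simpl; try tauto.
      * intros n' c' _. apply gf_pos.
      * intros p Hp [->|[]]. exfalso; eauto.
  - destruct (frostman_union gf D (S n) (n + S d) (children c) gf_pos (children_NoDup c))
      as (W & cov & A & B & C & E & F).
    { intros c' _. rewrite <- Nat.add_succ_comm. apply IH. }
    assert (A' : forall pw, In pw W -> D (fst pw) /\ cell n (fst pw) = c /\ 0 <= snd pw).
    { intros pw Hp. destruct (A pw Hp) as (? & ? & ?). rewrite <- in_children. auto. }
    destruct (Rle_lt_dec (total W) (gf (/ 2 ^ n))) as [HT|HT].
    + exists W, cov. split; [|split; [|split; [|split]]].
      * intros pw Hp. destruct (A' pw Hp) as (? & ? & ?). simpl; auto.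
      * intros n' c' Hn. destruct (Nat.eq_dec n' n) as [->|]; [|apply B; lia].
        eapply Rle_trans; [apply mass_le_total; apply A'|exact HT].
      * intros nc Hi. specialize (C nc Hi). lia.
      * intros p Hp [->|[]]. apply E; [exact Hp|]. now apply in_children.
      * exact F.
    + pose proof (gf_pos n) as Hg. set (s := gf (/ 2 ^ n) / total W).
      assert (Hs : 0 <= s) by (apply Rdiv_le_0_compat; lra).
      assert (Hs1 : s <= 1) by (apply Rmult_le_reg_r with (total W); [lra|];
        unfold s; field_simplify; lra).
      assert (HsT : s * total W = gf (/ 2 ^ n)) by (unfold s; field; lra).
      set (V := map (fun pw => (fst pw, s * snd pw)) W).
      assert (HV : total V = gf (/ 2 ^ n)).
      { unfold total, V. rewrite lsum_map. cbn [snd]. rewrite lsum_scal. exact HsT. }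
      assert (HVp : forall pw, In pw V -> D (fst pw) /\ cell n (fst pw) = c /\ 0 <= snd pw).
      { intros pw Hp. apply in_map_iff in Hp as (qw & <- & Hq).
        destruct (A' qw Hq) as (? & ? & ?). cbn [fst snd]. repeat split; auto. nra. }
      exists V, [(n, c)]. split; [|split; [|split; [|split]]].
      * intros pw Hp. destruct (HVp pw Hp) as (? & ? & ?). simpl; auto.
      * intros n' c' Hn. destruct (Nat.eq_dec n' n) as [->|].
        -- rewrite <- HV. apply mass_le_total, HVp.
        -- apply Rle_trans with (mass n' c' W); [|apply B; lia].
           unfold mass, V. rewrite lsum_map. cbn [fst snd]. apply lsum_le. intros pw Hp.
           pose proof (indic_01 (cell n' (fst pw) = c')). destruct (A' pw Hp) as (_ & _ & ?).
           apply Rmult_le_compat_l; nra.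
      * intros nc [<-|[]]; simpl; lia.
      * intros q Hq [->|[]]. exists n. now left.
      * rewrite HV. unfold cost; simpl; lra.
Qed.

(** * Incidences between segments and squares *)

(** For unit vectors this is the sine of the angle between them, so its absolute value does not
    distinguish [e] from [- e]. *)
Definition cross (u v : pt) : R := fst u * snd v - snd u * fst v.
Definition seg_pt (a e : pt) (t : R) : pt := (fst a + t * fst e, snd a + t * snd e).
Definition meets (k : nat) (l : pt -> Prop) (c : Z * Z) : Prop := exists p, l p /\ cell k p = c.

Lemma seg_pt_dist a e t t' : circle e -> dist2 (seg_pt a e t) (seg_pt a e t') = Rabs (t - t').
Proof.
  intros He. unfold dist2, seg_pt, circle in *; cbn [fst snd].
  rewrite <- sqrt_Rsqr_abs. f_equal. unfold Rsqr.
  transitivity ((t - t') * (t - t') * (fst e ^ 2 + snd e ^ 2)); [ring|rewrite He; ring].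
Qed.

(** Points are sampled along the segment one square side apart. Every other point is within one side
    of a sample, so its square is among the nine around the square of that sample. *)
Lemma segment_cells_count k a e T0 lam qs :
  circle e -> 0 <= lam -> NoDup qs ->
  (forall c, In c qs -> exists t, T0 <= t <= T0 + lam /\ cell k (seg_pt a e t) = c) ->
  INR (length qs) <= 9 * (lam * 2 ^ S k + 1).
Proof.
  intros He Hl Hnd H. pose proof (two_pow_gt0 (S k)) as Hp.
  set (U := Z.to_nat (Int_part (lam * 2 ^ S k))).
  set (pu := fun u => cell k (seg_pt a e (T0 + INR u * / 2 ^ S k))).
  assert (HU0 : (0 <= Int_part (lam * 2 ^ S k))%Z).
  { pose proof (Int_part_bounds (lam * 2 ^ S k)). assert (0 <= lam * 2 ^ S k) by (apply Rmult_le_pos; lra).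
    enough (IZR (-1) < IZR (Int_part (lam * 2 ^ S k))) as K by (apply lt_IZR in K; lia). lra. }
  assert (HU : INR U <= lam * 2 ^ S k).
  { unfold U. rewrite INR_IZR_INZ, Z2Nat.id by exact HU0. apply Int_part_bounds. }
  apply Rle_trans with (INR (length (flat_map (fun u => box (pu u) 1) (seq 0 (S U))))).
  - apply le_INR, NoDup_incl_length; [exact Hnd|]. intros c Hc.
    destruct (H c Hc) as (t & Ht & <-). apply in_flat_map.
    set (y := 2 ^ S k * (t - T0)).
    assert (Hy : 0 <= y <= lam * 2 ^ S k) by (unfold y; nra).
    assert (Hi : (0 <= Int_part y <= Int_part (lam * 2 ^ S k))%Z).
    { pose proof (Int_part_bounds y). pose proof (Int_part_bounds (lam * 2 ^ S k)). split.
      - enough (IZR (-1) < IZR (Int_part y)) as K by (apply lt_IZR in K; lia). lra.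
      - enough (IZR (Int_part y) < IZR (Int_part (lam * 2 ^ S k) + 1)) as K by
          (apply lt_IZR in K; lia). rewrite plus_IZR. lra. }
    exists (Z.to_nat (Int_part y)). split; [apply in_seq; unfold U; lia|].
    apply cell_in_box. rewrite seg_pt_dist, INR_IZR_INZ, Z2Nat.id by (auto; lia).
    rewrite <- (Rabs_pos_eq (2 ^ S k)) at 1 by lra. rewrite <- Rabs_mult.
    replace (2 ^ S k * (t - (T0 + IZR (Int_part y) * / 2 ^ S k))) with (y - IZR (Int_part y))
      by (unfold y; field; lra).
    pose proof (Int_part_bounds y). simpl. rewrite Rabs_pos_eq; lra.
  - enough (length (flat_map (fun u => box (pu u) 1) (seq 0 (S U))) = (9 * S U)%nat) as ->.
    + rewrite mult_INR, (S_INR U). replace (INR 9) with 9 by (simpl; lra). lra.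
    + rewrite (length_flat_map_const _ 9), length_seq; [reflexivity|]. intros; apply box_length.
Qed.

(** The left side is the distance from [p] to the line through [q] in direction [e]. *)
Lemma cross_le_dist p q e : circle e ->
  Rabs (cross (fst p - fst q, snd p - snd q) e) <= dist2 p q.
Proof.
  unfold circle, cross, dist2; cbn [fst snd]. intros He.
  set (x := fst p - fst q). set (y := snd p - snd q).
  rewrite <- sqrt_Rsqr_abs. apply sqrt_le_1_alt. unfold Rsqr.
  replace (x ^ 2 + y ^ 2) with ((x ^ 2 + y ^ 2) * (fst e ^ 2 + snd e ^ 2)) by (rewrite He; ring).
  pose proof (pow2_ge_0 (x * fst e + y * snd e)). nra.
Qed.

Lemma cross_le_1 e e' : circle e -> circle e' -> Rabs (cross e e') <= 1.
Proof.
  unfold circle, cross. intros H H'. apply Rabs_le.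
  pose proof (pow2_ge_0 (fst e * fst e' + snd e * snd e')).
  assert ((fst e * snd e' - snd e * fst e') ^ 2 <= 1).
  { replace 1 with ((fst e ^ 2 + snd e ^ 2) * (fst e' ^ 2 + snd e' ^ 2)) by (rewrite H, H'; ring).
    nra. }
  split; nra.
Qed.

(** The first bound uses the length of one segment alone. For the second, a common square puts a
    point of [l] within [/ 2 ^ k] of the line carrying [l'], hence in a stretch of length
    [2 * / 2 ^ k / Rabs (cross e e')]. *)
Lemma two_segments_count k a e len a' e' len' (l l' : pt -> Prop) m qs :
  circle e -> circle e' -> 1 <= m -> len <= m ->
  (forall p, l p -> exists t, 0 <= t <= len /\ p = seg_pt a e t) ->
  (forall p, l' p -> exists t, 0 <= t <= len' /\ p = seg_pt a' e' t) ->
  NoDup qs -> (forall c, In c qs -> meets k l c /\ meets k l' c) ->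
  INR (length qs) <= 45 * m * 2 ^ k /\ INR (length qs) * Rabs (cross e e') <= 45 * m.
Proof.
  intros He He' Hm Hlen Hl Hl' Hnd H. split.
  - apply Rle_trans with (9 * (m * 2 ^ S k + 1)).
    + apply segment_cells_count with a e 0; auto; [lra|].
      intros c Hc. destruct (H c Hc) as [(p & Hp & <-) _].
      destruct (Hl p Hp) as (t & Ht & ->). exists t; split; [lra|reflexivity].
    + assert (1 <= 2 ^ k) by (apply pow_R1_Rle; lra). simpl. nra.
  - destruct (Req_dec (cross e e') 0) as [E|E]; [rewrite E, Rabs_R0; lra|].
    pose proof (Rabs_pos_lt _ E) as Hth. pose proof (cross_le_1 e e' He He') as Hth1.
    set (th := cross e e') in *. set (ka := cross (fst a - fst a', snd a - snd a') e').
    pose proof (inv2_pos k) as Hd. pose proof (two_pow_gt0 k) as Hk2.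
    assert (K : INR (length qs) <= 9 * (2 * / 2 ^ k / Rabs th * 2 ^ S k + 1)).
    (* Along [l] the signed distance to the second line is [th * t + ka], so [t] stays within
       [/ 2 ^ k / Rabs th] of the zero [- ka / th]. *)
    { apply segment_cells_count with a e (- ka / th - / 2 ^ k / Rabs th); auto.
      - apply Rdiv_le_0_compat; lra.
      - intros c Hc. destruct (H c Hc) as [(p & Hp & Hpc) (p' & Hp' & Hpc')].
        destruct (Hl p Hp) as (t & Ht & Ep). destruct (Hl' p' Hp') as (t' & Ht' & Ep').
        exists t. split; [|now rewrite <- Ep].
        pose proof (cross_le_dist p p' e' He') as Hc1.
        pose proof (cell_dist k p p' ltac:(congruence)) as Hc2.
        replace (cross (fst p - fst p', snd p - snd p') e') with (th * (t + ka / th)) in Hc1.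
        2:{ rewrite Ep, Ep'. unfold seg_pt, ka, th, cross in *; cbn [fst snd]. field. exact E. }
        rewrite Rabs_mult in Hc1.
        assert (Hc3 : Rabs (t + ka / th) <= / 2 ^ k / Rabs th).
        { apply Rmult_le_reg_l with (Rabs th); [exact Hth|].
          replace (Rabs th * (/ 2 ^ k / Rabs th)) with (/ 2 ^ k)
            by (field; split; lra). lra. }
        apply Rabs_le_between in Hc3. unfold Rdiv in *. lra. }
    apply Rle_trans with (9 * (2 * / 2 ^ k / Rabs th * 2 ^ S k + 1) * Rabs th).
    + apply Rmult_le_compat_r; lra.
    + replace (9 * (2 * / 2 ^ k / Rabs th * 2 ^ S k + 1) * Rabs th) with (36 + 9 * Rabs th).
      * lra.
      * simpl. field. split; lra.
Qed.

(** The kernel [min (1 / th, 2 ^ (n0 + d))] is dominated by a dyadic sum of indicators, so that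
    integrating it only requires the masses of the sets [th <= / 2 ^ n]. *)
Lemma dyadic_kernel_bound n0 d B th x :
  0 <= B -> 0 <= th -> x <= B * 2 ^ (n0 + d) -> x * th <= B ->
  x <= B * (2 ^ n0 + 2 * lsum (fun n => 2 ^ n * indic (th <= / 2 ^ n)) (seq n0 (S d))).
Proof.
  intros HB Hth. revert x.
  assert (Hge : forall n l, 0 <= lsum (fun n => 2 ^ n * indic (th <= / 2 ^ n)) (seq n l)).
  { intros n l. apply lsum_ge0. intros i _. apply Rmult_le_pos; [left; apply two_pow_gt0|apply indic_01]. }
  induction d as [|d IH]; intros x Hx Hxt.
  - rewrite Nat.add_0_r in Hx. specialize (Hge n0 1%nat). nra.
  - rewrite seq_S, lsum_app. rewrite <- plus_n_Sm in *.
    set (s := lsum _ (seq n0 (S d))) in *. cbn [lsum fold_right].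
    pose proof (two_pow_gt0 n0). pose proof (two_pow_gt0 (S (n0 + d))).
    pose proof (Hge n0 (S d)) as Hs. fold s in Hs.
    pose proof (indic_01 (th <= / 2 ^ S (n0 + d))) as Hi.
    destruct (Rle_lt_dec th (/ 2 ^ (n0 + d))) as [H1|H1].
    + destruct (Rle_lt_dec th (/ 2 ^ S (n0 + d))) as [H2|H2].
      * rewrite indic_true by exact H2. nra.
      (* The finest indicator vanishes here; the one at level [n0 + d] contributes [2 ^ (n0 + d)],
         and the factor 2 before the sum makes up for the lost level. *)
      * assert (2 ^ (n0 + d) <= s).
        { unfold s. rewrite seq_S, lsum_app. cbn [lsum fold_right].
          rewrite (indic_true _ H1). specialize (Hge n0 d). lra. }
        rewrite (indic_false _ (Rlt_not_le _ _ H2)).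
        apply Rle_trans with (1 := Hx). apply Rmult_le_compat_l; [exact HB|]. simpl in *. lra.
    + assert (Hx' : x <= B * 2 ^ (n0 + d)).
      { destruct (Rle_lt_dec x 0); [pose proof (two_pow_gt0 (n0 + d)); nra|].
        pose proof (two_pow_gt0 (n0 + d)).
        assert (1 < th * 2 ^ (n0 + d)).
        { rewrite <- (Rinv_l (2 ^ (n0 + d))) by lra. apply Rmult_lt_compat_r; lra. }
        nra. }
      specialize (IH x Hx' Hxt). fold s in IH.
      rewrite (indic_false (th <= / 2 ^ S (n0 + d))); [lra|].
      pose proof (inv2_le (n0 + d) (S (n0 + d)) ltac:(lia)). lra.
Qed.

(** With [c] and [s] the cosine and sine of the angle, [0 <= c] gives
    [dist2 e' e ^ 2 = 2 - 2 * c <= 2 * s ^ 2], and [sqrt 2 <= 3 / 2]. For [c < 0], [- e] takes the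
    place of [e]. *)
Lemma cross_small_close e e' r :
  circle e -> circle e' -> Rabs (cross e e') <= r ->
  dist2 e' e <= 3 / 2 * r \/ dist2 e' (- fst e, - snd e) <= 3 / 2 * r.
Proof.
  unfold circle, cross, dist2; cbn [fst snd]. intros He He' Hr.
  assert (0 <= r) by (eapply Rle_trans; [apply Rabs_pos|exact Hr]).
  apply Rabs_le_between in Hr.
  set (c := fst e * fst e' + snd e * snd e').
  set (s := fst e * snd e' - snd e * fst e') in *.
  assert (c ^ 2 + s ^ 2 = 1).
  { transitivity ((fst e ^ 2 + snd e ^ 2) * (fst e' ^ 2 + snd e' ^ 2)); [unfold c, s; ring|].
    rewrite He, He'; ring. }
  assert (s ^ 2 <= r ^ 2) by nra.
  rewrite <- (sqrt_pow2 (3 / 2 * r)) by lra.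
  destruct (Rle_lt_dec 0 c); [left|right]; apply sqrt_le_1_alt.
  - replace ((fst e' - fst e) ^ 2 + (snd e' - snd e) ^ 2) with
      ((fst e ^ 2 + snd e ^ 2) + (fst e' ^ 2 + snd e' ^ 2) - 2 * c) by (unfold c; ring).
    rewrite He, He'. nra.
  - replace ((fst e' - - fst e) ^ 2 + (snd e' - - snd e) ^ 2) with
      ((fst e ^ 2 + snd e ^ 2) + (fst e' ^ 2 + snd e' ^ 2) + 2 * c) by (unfold c; ring).
    rewrite He, He'. nra.
Qed.

(** Up to a factor 4, the dyadic lower sum of the integral of [gf u / u ^ 2] from [/ 2 ^ (n0 + d)]
    to [2 * / 2 ^ n0]. *)
Definition Gsum (gf : R -> R) (n0 d : nat) : R :=
  lsum (fun n => 2 ^ n * gf (/ 2 ^ n)) (seq n0 (S d)).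

Lemma frostman_total gf D n0 k cs W cov :
  (n0 <= k)%nat -> frostman gf D n0 k cs W cov ->
  total W <= INR (length cs) * gf (/ 2 ^ n0).
Proof.
  intros Hk (A & B & _).
  assert (Ht : total W = lsum (fun pw => indic True * snd pw) W).
  { apply lsum_ext. intros. rewrite indic_true by exact I. ring. }
  assert (HWn0 : forall c, mass n0 c W <= gf (/ 2 ^ n0)) by (intros; apply B; lia).
  rewrite Ht. apply (selected_mass_le n0 (fun _ => True)); auto; intros; now apply A.
Qed.

Lemma gf_le_Gsum gf n0 d :
  (forall n, 0 <= gf (/ 2 ^ n)) -> 2 ^ n0 * gf (/ 2 ^ n0) <= Gsum gf n0 d.
Proof.
  intros Hg. unfold Gsum. cbn [seq lsum fold_right].
  enough (0 <= lsum (fun n => 2 ^ n * gf (/ 2 ^ n)) (seq (S n0) d)) by (unfold lsum in *; lra).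
  apply lsum_ge0. intros n _. apply Rmult_le_pos; [left; apply two_pow_gt0|apply Hg].
Qed.

(** The energy of [W] seen from [e]: directions within angle about [/ 2 ^ n] of [e] or [- e] lie in
    boundedly many squares of level [n], each of mass at most [gf (/ 2 ^ n)]. The term [2 ^ n0] is
    absorbed by the bound on the total mass. *)
Lemma frostman_energy gf (D : pt -> Prop) n0 d cs W cov e :
  (forall n, 0 <= gf (/ 2 ^ n)) -> (forall e, D e -> circle e) -> circle e ->
  frostman gf D n0 (n0 + d) cs W cov ->
  lsum (fun pw => snd pw * (2 ^ n0 + 2 * lsum (fun n => 2 ^ n *
    indic (Rabs (cross e (fst pw)) <= / 2 ^ n)) (seq n0 (S d)))) W
  <= (INR (length cs) + 196) * Gsum gf n0 d.
Proof.
  intros Hg HD He HF. pose proof (frostman_total gf D n0 (n0 + d) cs W cov ltac:(lia) HF) as HT.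
  destruct HF as (A & B & _).
  rewrite (lsum_ext _ (fun pw => 2 ^ n0 * snd pw + 2 * lsum (fun n => 2 ^ n *
    (indic (Rabs (cross e (fst pw)) <= / 2 ^ n) * snd pw)) (seq n0 (S d)))).
  2:{ intros pw _. rewrite Rmult_plus_distr_l. f_equal; [ring|].
      rewrite <- !lsum_scal. apply lsum_ext. intros; ring. }
  rewrite lsum_plus, !lsum_scal, lsum_swap.
  assert (H1 : 2 ^ n0 * lsum snd W <= INR (length cs) * Gsum gf n0 d).
  { pose proof (gf_le_Gsum gf n0 d Hg). pose proof (pos_INR (length cs)).
    pose proof (two_pow_gt0 n0). unfold total in *.
    apply Rle_trans with (INR (length cs) * (2 ^ n0 * gf (/ 2 ^ n0))); nra. }
  enough (lsum (fun n => lsum (fun pw => 2 ^ n *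
    (indic (Rabs (cross e (fst pw)) <= / 2 ^ n) * snd pw)) W) (seq n0 (S d)) <= 98 * Gsum gf n0 d)
    by (unfold total in *; lra).
  unfold Gsum. rewrite <- lsum_scal. apply lsum_le. intros n Hn. apply in_seq in Hn.
  rewrite lsum_scal. pose proof (two_pow_gt0 n).
  enough (lsum (fun pw => indic (Rabs (cross e (fst pw)) <= / 2 ^ n) * snd pw) W
    <= 98 * gf (/ 2 ^ n)) by nra.
  (* [98 = 2 * 7 ^ 2]: by [cross_small_close] the directions are within [3 / 2 * / 2 ^ n], three
     square sides, of [e] or [- e]. *)
  replace 98 with (INR (length (box (cell n e) 3 ++ box (cell n (- fst e, - snd e)) 3))).
  2:{ rewrite length_app, !box_length. simpl; lra. }
  apply (selected_mass_le n (fun p => Rabs (cross e p) <= / 2 ^ n)).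
  - apply A.
  - intros pw Hp Hc. apply in_app_iff.
    assert (E : 2 ^ S n * (3 / 2 * / 2 ^ n) = INR 3) by (simpl; field; lra).
    pose proof (two_pow_gt0 (S n)).
    destruct (cross_small_close e (fst pw) (/ 2 ^ n) He (HD _ (proj1 (A pw Hp))) Hc);
      [left|right]; apply cell_in_box; rewrite <- E; apply Rmult_le_compat_l; lra.
  - intros c. apply B. lia.
Qed.

(** The box reaches [2 ^ S n0] squares, that is distance 1, from the origin; [nodup] provides the
    distinctness that [frostman_union] asks for. *)
Definition roots (n0 : nat) : list (Z * Z) :=
  nodup (fun x y : Z * Z => excluded_middle_informative (x = y)) (box (0, 0)%Z (2 ^ S n0)).

Lemma circle_in_roots n0 e : circle e -> In (cell n0 e) (roots n0).
Proof.
  intros He. apply nodup_In.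
  replace (0, 0)%Z with (cell n0 (0, 0)).
  2:{ unfold cell; cbn [fst snd]. rewrite Rmult_0_r. f_equal; symmetry; apply Int_part_spec; lra. }
  apply cell_in_box. rewrite pow_INR. replace (INR 2) with 2 by (simpl; lra).
  replace (dist2 e (0, 0)) with 1; [lra|].
  unfold dist2; cbn [fst snd]. rewrite !Rminus_0_r, He, sqrt_1. reflexivity.
Qed.

(* Cordoba's argument: double counting of incidences, Cauchy-Schwarz over the squares, and the bound
   [min (1 / angle, 2^k)] on the number of squares met by two segments. *)
Lemma incidence_bound gf (D : pt -> Prop) n0 d m QL t (l : pt -> pt -> Prop) :
  (forall n, 0 <= gf (/ 2 ^ n)) -> 1 <= m ->
  (forall e, D e -> circle e /\ exists a len, len <= m /\
     forall p, l e p -> exists t, 0 <= t <= len /\ p = seg_pt a e t) ->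
  0 <= t ->
  NoDup QL -> (forall e, D e -> t <= lsum (fun c => indic (meets (n0 + d) (l e) c)) QL) ->
  exists cov,
    (forall nc, In nc cov -> (n0 <= fst nc <= n0 + d)%nat) /\
    (forall e, D e -> exists n, In (n, cell n e) cov) /\
    cost gf cov <= INR (length (roots n0)) * Gsum gf n0 d /\
    cost gf cov * t ^ 2 <=
      45 * m * (INR (length (roots n0)) + 196) * INR (length QL) * Gsum gf n0 d.
Proof.
  intros Hg Hm HD Ht HQ HN. set (k := (n0 + d)%nat) in *.
  destruct (frostman_union gf D n0 k (roots n0) Hg (NoDup_nodup _ _)) as (W & cov & HF).
  { intros c _. now apply frostman_cell. }
  assert (HDc : forall e, D e -> circle e) by (intros; now apply HD).
  pose proof (frostman_total gf D n0 k _ W cov ltac:(lia) HF) as HT.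
  pose proof (fun e He => frostman_energy gf D n0 d _ W cov e Hg HDc He HF) as HE.
  destruct HF as (A & B & C & HC & HF).
  set (r := INR (length (roots n0))) in *. set (G := Gsum gf n0 d) in *.
  exists cov. split; [exact C|]. split.
  { intros e He. apply HC; [exact He|]. now apply circle_in_roots, HDc. }
  rewrite HF.
  pose proof (gf_le_Gsum gf n0 d Hg) as HG. fold G in HG.
  assert (1 <= 2 ^ n0) by (apply pow_R1_Rle; lra).
  assert (0 <= r) by apply pos_INR. pose proof (Hg n0).
  split; [apply Rle_trans with (1 := HT), Rmult_le_compat_l; nra|].
  set (T := total W) in *.
  assert (HT0 : 0 <= T) by (apply lsum_ge0; intros; now apply A).
  set (J := fun (pw : pt * R) c => indic (meets k (l (fst pw)) c)).
  assert (HB : 0 <= 45 * m) by lra.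
  (* Weighted incidences, counted direction by direction. *)
  assert (HI1 : T * t <= lsum (fun c => lsum (fun pw => snd pw * J pw c) W) QL).
  { rewrite <- lsum_swap. unfold T, total.
    rewrite Rmult_comm, <- lsum_scal. apply lsum_le. intros pw Hp. rewrite lsum_scal, Rmult_comm.
    apply Rmult_le_compat_l; [now apply A|]. apply HN. now apply A. }
  (* The square expands into pairs of directions. For each pair, [two_segments_count] bounds the
     number of common squares, and [frostman_energy] sums over the second direction. *)
  assert (HI2 : lsum (fun c => lsum (fun pw => snd pw * J pw c) W ^ 2) QL
    <= 45 * m * (r + 196) * G * T).
  { rewrite (lsum_ext _ (fun c => lsum (fun pw => lsum (fun qw =>
      snd pw * snd qw * (J pw c * J qw c)) W) W)).
    2:{ intros c _. simpl. rewrite Rmult_1_r, <- lsum_scal. apply lsum_ext. intros pw _.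
        rewrite Rmult_comm, <- lsum_scal. apply lsum_ext. intros; ring. }
    rewrite lsum_swap. unfold T, total. rewrite <- lsum_scal. apply lsum_le. intros pw Hp.
    destruct (A pw Hp) as (HDp & _ & Hp0). destruct (HD _ HDp) as (Hcp & a & len & Hlen & Hl).
    rewrite lsum_swap.
    apply Rle_trans with (snd pw * (45 * m * ((r + 196) * G))); [|right; ring].
    apply Rle_trans with (snd pw * (45 * m * lsum (fun qw => snd qw * (2 ^ n0 + 2 *
      lsum (fun n => 2 ^ n * indic (Rabs (cross (fst pw) (fst qw)) <= / 2 ^ n)) (seq n0 (S d)))) W)).
    2:{ apply Rmult_le_compat_l; [exact Hp0|]. apply Rmult_le_compat_l; auto. }
    rewrite <- !lsum_scal. apply lsum_le. intros qw Hq. rewrite lsum_scal.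
    destruct (A qw Hq) as (HDq & _ & Hq0). destruct (HD _ HDq) as (Hcq & a' & len' & Hlen' & Hl').
    rewrite Rmult_assoc. apply Rmult_le_compat_l; [exact Hp0|].
    rewrite Rmult_comm, (Rmult_comm (snd qw)), <- Rmult_assoc.
    apply Rmult_le_compat_r; [exact Hq0|].
    rewrite (lsum_ext _ (fun c => indic (meets k (l (fst pw)) c /\ meets k (l (fst qw)) c))).
    2:{ intros c _. unfold J, indic. repeat destruct excluded_middle_informative; try tauto; ring. }
    rewrite lsum_indic_filter. set (qs := filter _ QL).
    destruct (two_segments_count k a (fst pw) len a' (fst qw) len' (l (fst pw)) (l (fst qw)) m qs)
      as [K1 K2]; auto.
    { now apply NoDup_filter. }
    { intros c Hc. apply filter_In in Hc as [_ Hc].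
      destruct excluded_middle_informative; [assumption|discriminate]. }
    apply dyadic_kernel_bound; auto. apply Rabs_pos. }
  pose proof (lsum_cauchy (fun c => lsum (fun pw => snd pw * J pw c) W) QL) as HI3.
  set (X := lsum (fun c => lsum (fun pw => snd pw * J pw c) W) QL) in *.
  assert (HG0 : 0 <= G) by nra.
  assert (HR : 0 <= 45 * m * (r + 196) * INR (length QL) * G).
  { repeat apply Rmult_le_pos; try lra. apply pos_INR. }
  (* The pair count carries one factor [T] against two in [(T * t) ^ 2]; one is cancelled at the
     end, where [T = 0] is trivial. *)
  assert (HI4 : T * (T * t ^ 2) <= T * (45 * m * (r + 196) * INR (length QL) * G)).
  { apply Rle_trans with (X ^ 2).
    - assert (0 <= T * t) by nra. replace (T * (T * t ^ 2)) with ((T * t) ^ 2) by ring. nra.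
    - eapply Rle_trans; [exact HI3|].
      apply Rle_trans with (INR (length QL) * (45 * m * (r + 196) * G * T)); [|right; ring].
      apply Rmult_le_compat_l; [apply pos_INR|exact HI2]. }
  destruct HT0 as [HT0|<-]; [|lra].
  now apply Rmult_le_reg_l with T.
Qed.

(** * The integral C(delta) and its dyadic sums *)

Lemma ex_RInt_lsum {A} (f : A -> R -> R) l a b :
  (forall x, In x l -> ex_RInt (f x) a b) -> ex_RInt (fun u => lsum (fun x => f x u) l) a b.
Proof.
  induction l as [|x l IH]; intros H; simpl.
  - apply (ex_RInt_const a b 0).
  - apply (ex_RInt_plus (f x) (fun u => lsum (fun x => f x u) l)).
    + apply H; now left.
    + apply IH. intros y Hy; apply H; now right.
Qed.

(** By monotonicity the indicator is 0 to the left and 1 to the right of the supremum [c] of the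
    points where [g] is below [y], so the integral splits at [c]. *)
Lemma ex_RInt_threshold g a b y :
  0 < a -> a <= b -> (forall u v, a <= u -> u <= v -> v <= b -> g u <= g v) ->
  ex_RInt (fun u => indic (y <= g u) * / u ^ 2) a b.
Proof.
  intros Ha Hab Hg.
  (* The alternative [u = a] keeps the set nonempty when [g] is nowhere below [y]. *)
  destruct (completeness (fun u => u = a \/ a <= u <= b /\ g u < y)) as [c [Hub Hlub]].
  { exists b. intros u [->|Hu]; lra. }
  { exists a. now left. }
  assert (Hac : a <= c) by (apply Hub; now left).
  assert (Hcb : c <= b) by (apply Hlub; intros u [->|Hu]; lra).
  apply ex_RInt_Chasles with c.
  - apply (ex_RInt_ext (fun _ => 0)); [|apply (ex_RInt_const a c 0)].
    rewrite Rmin_left, Rmax_right by lra. intros u Hu.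
    rewrite indic_false; [now rewrite Rmult_0_l|]. intros Hy.
    assert (c <= u); [|lra]. apply Hlub. intros v [->|[Hv Hv']]; [lra|].
    destruct (Rle_lt_dec v u); [assumption|]. specialize (Hg u v). lra.
  - apply (ex_RInt_ext (fun u => / u ^ 2)).
    + rewrite Rmin_left, Rmax_right by lra. intros u Hu.
      rewrite indic_true; [now rewrite Rmult_1_l|]. apply Rnot_lt_le. intros Hy.
      assert (u <= c); [|lra]. apply Hub. right. lra.
    + apply (ex_RInt_continuous (fun u => / u ^ 2)).
      rewrite Rmin_left, Rmax_right by lra. intros u Hu.
      apply (ex_derive_continuous (fun u => / u ^ 2)). auto_derive. nra.
Qed.

(** The sum is the integer part of [x]. *)
Lemma layer_cake x M :
  0 <= x <= INR M -> Rabs (x - lsum (fun j => indic (INR j <= x)) (seq 1 M)) <= 1.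
Proof.
  intros Hx. induction M as [|M IH].
  - simpl in *. apply Rabs_le; lra.
  - rewrite seq_S, lsum_app. cbn [lsum fold_right].
    destruct (Rle_lt_dec x (INR M)) as [H|H].
    + rewrite (indic_false (INR (1 + M) <= x)).
      * rewrite !Rplus_0_r. apply IH. lra.
      * change (1 + M)%nat with (S M). rewrite S_INR. lra.
    + rewrite (lsum_ext _ (fun _ => 1)).
      * rewrite lsum_const, length_seq. rewrite S_INR in Hx.
        change (1 + M)%nat with (S M). rewrite S_INR.
        pose proof (indic_01 (INR M + 1 <= x)). apply Rabs_le. lra.
      * intros j Hj. apply in_seq in Hj. apply indic_true.
        apply Rle_trans with (INR M); [apply le_INR; lia|lra].
Qed.

(* [g] is a uniform limit of step functions, obtained by quantizing its values. *)
Lemma ex_RInt_monotone_div_sqr g a b :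
  0 < a -> a <= b -> (forall u, a <= u <= b -> 0 <= g u) ->
  (forall u v, a <= u -> u <= v -> v <= b -> g u <= g v) ->
  ex_RInt (fun u => g u / u ^ 2) a b.
Proof.
  intros Ha Hab Hg0 Hg.
  (* Clamping to [[a, b]] makes the convergence uniform on the whole line, as [filterlim_RInt]
     asks. *)
  set (cl := fun u => Rmax a (Rmin b u)).
  assert (Hcl : forall u, a <= cl u <= b).
  { intros u. unfold cl. split; [apply Rmax_l|]. apply Rmax_lub; [lra|apply Rmin_l]. }
  assert (Hcl' : forall u, a < u < b -> cl u = u).
  { intros u Hu. unfold cl. rewrite Rmin_right, Rmax_right; lra. }
  set (M := fun n => Z.to_nat (up (INR (S n) * g b))).
  assert (HM : forall n, INR (S n) * g b <= INR (M n)).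
  { intros n. pose proof (archimed (INR (S n) * g b)). unfold M.
    destruct (Z_le_gt_dec 0 (up (INR (S n) * g b))) as [H0|H0].
    - rewrite (INR_IZR_INZ (Z.to_nat _)), Z2Nat.id by exact H0. lra.
    - apply Rle_trans with 0; [|apply pos_INR].
      assert (IZR (up (INR (S n) * g b)) <= 0) by (apply IZR_le; lia). lra. }
  (* On [[a, b]], [g] is rounded down to a multiple of [/ INR (S n)], written as a sum of threshold
     functions. *)
  set (f := fun n u => / INR (S n) * lsum (fun j => indic (INR j <= INR (S n) * g u) * / u ^ 2)
    (seq 1 (M n))).
  assert (HN : forall n, 0 < INR (S n)) by (intros; apply lt_0_INR; lia).
  assert (Hint : forall n, ex_RInt (fun u => f n (cl u)) a b).
  { intros n. apply (ex_RInt_ext (f n)).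
    - rewrite Rmin_left, Rmax_right by lra. intros u Hu. now rewrite Hcl'.
    - apply (ex_RInt_scal (fun u => lsum (fun j => indic (INR j <= INR (S n) * g u) * / u ^ 2)
        (seq 1 (M n)))).
      apply (ex_RInt_lsum (fun j u => indic (INR j <= INR (S n) * g u) * / u ^ 2)).
      intros j _. apply (ex_RInt_threshold (fun u => INR (S n) * g u)); auto.
      intros u v Hu Huv Hv. apply Rmult_le_compat_l; [left; apply HN|auto]. }
  apply (ex_RInt_ext (fun u => g (cl u) / cl u ^ 2)).
  { rewrite Rmin_left, Rmax_right by lra. intros u Hu. now rewrite Hcl'. }
  destruct (filterlim_RInt (fun n u => f n (cl u)) a b eventually _
    (fun u => g (cl u) / cl u ^ 2) (fun n => RInt (fun u => f n (cl u)) a b)) as (I & _ & HI).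
  - intros n. apply RInt_correct, Hint.
  - apply filterlim_locally. intros eps.
    destruct (nfloor_ex (/ (a ^ 2 * eps))) as [n0 Hn0].
    { left. apply Rinv_0_lt_compat, Rmult_lt_0_compat; [apply pow_lt; lra|apply cond_pos]. }
    exists n0. intros n Hn u. change (Rabs (f n (cl u) - g (cl u) / cl u ^ 2) < eps).
    specialize (Hcl u). set (w := cl u) in *. unfold f.
    rewrite (lsum_ext _ (fun j => / w ^ 2 * indic (INR j <= INR (S n) * g w)))
      by (intros; ring). rewrite lsum_scal.
    set (s := lsum _ (seq 1 (M n))).
    assert (Hs : Rabs (INR (S n) * g w - s) <= 1).
    { apply layer_cake. specialize (HN n). split.
      - apply Rmult_le_pos; [lra|auto].
      - apply Rle_trans with (2 := HM n). apply Rmult_le_compat_l; [lra|]. apply Hg; lra. }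
    pose proof (HN n) as HNn. assert (Hw : 0 < w ^ 2) by (apply pow_lt; lra).
    replace (/ INR (S n) * (/ w ^ 2 * s) - g w / w ^ 2)
      with (- (/ INR (S n) * / w ^ 2 * (INR (S n) * g w - s))) by (field; lra).
    rewrite Rabs_Ropp, Rabs_mult.
    assert (Ha2 : 0 < a ^ 2) by (apply pow_lt; lra). pose proof (cond_pos eps) as He.
    assert (Hpos : 0 < / INR (S n) * / w ^ 2) by (apply Rmult_lt_0_compat; now apply Rinv_0_lt_compat).
    rewrite (Rabs_pos_eq (/ INR (S n) * / w ^ 2)) by lra.
    apply Rle_lt_trans with (/ INR (S n) * / w ^ 2 * 1); [apply Rmult_le_compat_l; lra|].
    rewrite Rmult_1_r, <- Rinv_mult. rewrite <- (Rinv_inv eps).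
    apply Rinv_lt_contravar.
    { apply Rmult_lt_0_compat; [now apply Rinv_0_lt_compat|now apply Rmult_lt_0_compat]. }
    assert (H1 : / (a ^ 2 * eps) < INR (S n)).
    { apply Rlt_le_trans with (1 := proj2 Hn0). rewrite S_INR. apply le_INR in Hn. lra. }
    assert (a ^ 2 <= w ^ 2) by (apply pow_incr; lra).
    apply Rlt_le_trans with (INR (S n) * a ^ 2); [|apply Rmult_le_compat_l; lra].
    replace (/ eps) with (/ (a ^ 2 * eps) * a ^ 2) by (field; lra).
    now apply Rmult_lt_compat_r.
  - exists I. exact HI.
Qed.

(** [Cint] picks its value by [epsilon], so it is the integral only once integrability is known. *)
Lemma Cint_RInt g x : 0 < x -> x <= 1 -> inH g -> Cint g x = RInt (fun u => g u / u ^ 2) x 1.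
Proof.
  intros Hx Hx1 (_ & Hg0 & Hg & _).
  assert (Hex : ex_RInt (fun u => g u / u ^ 2) x 1).
  { apply ex_RInt_monotone_div_sqr; auto; intros; [apply Hg0|apply Hg]; lra. }
  unfold Cint. destruct (epsilon_spec (inhabits 0) (fun I =>
    exists pr : Riemann_integrable (fun u => g u / u ^ 2) x 1, RiemannInt pr = I)) as [pr Hpr].
  { exists (RiemannInt (ex_RInt_Reals_0 _ _ _ Hex)). eexists; reflexivity. }
  rewrite <- Hpr. symmetry. apply RInt_Reals.
Qed.

(** With [a = / 2 ^ S n], monotonicity gives [g u / u ^ 2 >= g a / (2 * a) ^ 2] on [[a, 2 * a]], so
    this interval contributes at least a quarter of [2 ^ S n * g a]. *)
Lemma Gsum_le_Cint g n0 d :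
  inH g -> (1 <= n0)%nat -> Gsum g n0 d <= 4 * Cint g (/ 2 ^ (n0 + d)).
Proof.
  intros Hg Hn0.
  set (f := fun u => g u / u ^ 2).
  assert (Hx : forall n, 0 < / 2 ^ n <= 1).
  { intros n. split; [apply inv2_pos|]. rewrite <- Rinv_1. apply (inv2_le 0 n). lia. }
  rewrite Cint_RInt by (auto; apply Hx). fold f.
  destruct Hg as (_ & Hg0 & Hg & _).
  assert (Hex : forall a b, 0 < a -> a <= b -> ex_RInt f a b).
  { intros a b Ha Hb. apply ex_RInt_monotone_div_sqr; auto; intros; [apply Hg0|apply Hg]; lra. }
  assert (Hstep : forall n, 2 ^ S n * g (/ 2 ^ S n) + 4 * RInt f (/ 2 ^ n) 1
    <= 4 * RInt f (/ 2 ^ S n) 1).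
  { intros n. pose proof (Hx n). pose proof (Hx (S n)). pose proof (two_pow_gt0 (S n)).
    pose proof (inv2_S n) as E. pose proof (inv2_le n (S n) ltac:(lia)).
    rewrite <- (RInt_Chasles f (/ 2 ^ S n) (/ 2 ^ n) 1) by (apply Hex; lra).
    change plus with Rplus.
    enough (2 ^ S n * g (/ 2 ^ S n) / 4 <= RInt f (/ 2 ^ S n) (/ 2 ^ n)) by lra.
    set (a := / 2 ^ S n) in *. replace (/ 2 ^ n) with (2 * a) in * by lra.
    replace (2 ^ S n) with (/ a) by (unfold a; now rewrite Rinv_inv).
    apply Rle_trans with (RInt (fun _ => g a / (2 * a) ^ 2) a (2 * a)).
    - rewrite RInt_const. change scal with Rmult. right. field. lra.
    - apply RInt_le; [lra|apply ex_RInt_const|apply Hex; lra|].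
      intros u Hu. apply Rmult_le_compat; [apply Hg0; lra| |apply Hg; lra|].
      + left. apply Rinv_0_lt_compat, pow_lt. lra.
      + apply Rinv_le_contravar; [apply pow_lt; lra|apply pow_incr; lra]. }
  unfold Gsum. induction d as [|d IH].
  (* [1 <= n0] keeps the interval of the first term below 1. *)
  - destruct n0 as [|n]; [lia|]. rewrite Nat.add_0_r. cbn [seq lsum fold_right].
    enough (0 <= RInt f (/ 2 ^ n) 1) by (specialize (Hstep n); lra).
    specialize (Hx n). apply RInt_ge_0; [lra|apply Hex; lra|].
    intros u Hu. apply Rdiv_le_0_compat; [apply Hg0; lra|apply pow_lt; lra].
  - rewrite seq_S, lsum_app, <- plus_n_Sm. specialize (Hstep (n0 + d)%nat).
    cbn [lsum fold_right] in *. lra.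
Qed.

(** * Covers and contents *)

Lemma choice_fun {A B} (P : A -> B -> Prop) :
  (forall x, exists y, P x y) -> exists f, forall x, P x (f x).
Proof.
  intros H. exists (fun x => proj1_sig (constructive_indefinite_description _ (H x))).
  intros x. apply proj2_sig.
Qed.

Lemma sum_f_R0_lsum u N : sum_f_R0 u N = lsum u (seq 0 (S N)).
Proof.
  induction N as [|N IH]; [simpl; lra|].
  rewrite seq_S, lsum_app, <- IH. simpl. lra.
Qed.

Lemma lsum_list_prod {A B} (f : A -> B -> R) l l' :
  lsum (fun xy => f (fst xy) (snd xy)) (list_prod l l') = lsum (fun x => lsum (f x) l') l.
Proof.
  induction l as [|x l IH]; [reflexivity|].
  cbn [list_prod]. rewrite lsum_app, IH, lsum_map. reflexivity.
Qed.

Lemma lsum_le_partial u B l :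
  (forall i, 0 <= u i) -> (forall N, sum_f_R0 u N <= B) -> NoDup l -> lsum u l <= B.
Proof.
  intros Hu HB Hl. apply Rle_trans with (sum_f_R0 u (list_max l)); [|apply HB].
  rewrite sum_f_R0_lsum. apply lsum_incl; auto.
  intros i Hi. apply in_seq.
  pose proof (proj1 (list_max_le l (list_max l)) (le_n _)) as H.
  rewrite Forall_forall in H. specialize (H i Hi). lia.
Qed.

(** Otherwise a list of distinct elements of [P] could always be extended, and would outgrow [B]. *)
Lemma bounded_NoDup_list (P : nat -> Prop) B :
  (forall l, NoDup l -> (forall i, In i l -> P i) -> INR (length l) <= B) ->
  exists l, NoDup l /\ forall i, In i l <-> P i.
Proof.
  intros HB. apply NNPP. intros Hno.
  assert (H : forall n, exists l, NoDup l /\ (forall i, In i l -> P i) /\ length l = n).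
  { induction n as [|n (l & Hl & HP & Hn)].
    - exists []. repeat split; [constructor|intros _ []].
    - apply NNPP. intros Hn'. apply Hno. exists l. split; [exact Hl|].
      intros i; split; [apply HP|]. intros Hi. apply NNPP. intros Hil.
      apply Hn'. exists (i :: l). repeat split; [now constructor| |simpl; lia].
      intros j [<-|Hj]; auto. }
  destruct (INR_unbounded B) as [n Hn]. destruct (H n) as (l & Hl & HP & <-).
  specialize (HB l Hl HP). lra.
Qed.

Lemma NoDup_flat_map_disjoint {A B} (f : A -> list B) l :
  NoDup l -> (forall x, In x l -> NoDup (f x)) ->
  (forall x y z, In z (f x) -> In z (f y) -> x = y) -> NoDup (flat_map f l).
Proof.
  induction 1 as [|x l Hx _ IH]; intros Hf Hd; simpl; [constructor|].
  apply NoDup_app.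
  - apply Hf; now left.
  - apply IH; auto. intros y Hy; apply Hf; now right.
  - intros z Hz Hz'. apply in_flat_map in Hz' as (y & Hy & Hzy).
    now rewrite (Hd x y z Hz Hzy) in Hx.
Qed.

Lemma diam_spec F delta : diam_lt F delta -> is_lub (dists F) (diam F) /\ diam F < delta.
Proof.
  intros (d & Hd & Hlt).
  assert (H : is_lub (dists F) (diam F)).
  { unfold diam. apply epsilon_spec. eauto. }
  split; [exact H|]. now rewrite (is_lub_u _ _ _ H Hd).
Qed.

Lemma diam_ge0 F delta : diam_lt F delta -> 0 <= diam F.
Proof. intros H. apply diam_spec in H as [[H _] _]. apply H. now left. Qed.

Lemma dist2_le_diam F delta x y : diam_lt F delta -> F x -> F y -> dist2 x y <= diam F.
Proof. intros H Hx Hy. apply diam_spec in H as [[H _] _]. apply H. right; eauto. Qed.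

Lemma diam_bound (F : pt -> Prop) d :
  0 <= d -> (forall x y, F x -> F y -> dist2 x y <= d) ->
  (forall delta, d < delta -> diam_lt F delta) /\ diam F <= d.
Proof.
  intros Hd H.
  assert (Hub : is_upper_bound (dists F) d) by (intros r [->|(x & y & Hx & Hy & ->)]; auto).
  destruct (completeness (dists F)) as [c Hc].
  { now exists d. }
  { exists 0. now left. }
  assert (Hcd : c <= d) by (apply Hc, Hub).
  assert (Hlt : forall delta, d < delta -> diam_lt F delta).
  { intros delta Hdel. exists c. split; [exact Hc|lra]. }
  split; [exact Hlt|].
  destruct (diam_spec F (d + 1) (Hlt (d + 1) ltac:(lra))) as [Hl _].
  now rewrite (is_lub_u _ _ _ Hl Hc).
Qed.

(* [H^phi_delta(D) <= c], with the infimum attained. *)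
Definition small (phi : R -> R) (delta : R) (D : pt -> Prop) (c : R) : Prop :=
  exists F, delta_cover delta D F /\ forall N, sum_f_R0 (fun i => phi (diam (F i))) N <= c.

Lemma not_small phi delta D c eta :
  c < eta -> (forall F, delta_cover delta D F -> series_ge (fun i => phi (diam (F i))) eta) ->
  ~ small phi delta D c.
Proof.
  intros Hc H (F & HF & HN). destruct (H F HF c Hc) as [N HN']. specialize (HN N). lra.
Qed.

(** The covers of the pieces are merged into one sequence by Cantor pairing. *)
Lemma small_subadd phi delta (D : pt -> Prop) (Di : nat -> pt -> Prop) v c :
  inH phi -> (forall i, small phi delta (Di i) (v i)) ->
  (forall N, sum_f_R0 v N <= c) -> (forall p, D p -> exists i, Di i p) ->
  small phi delta D c.
Proof.
  intros (_ & Hphi & _) Hs Hc HD. apply choice_fun in Hs as [F HF].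
  exists (fun n => F (fst (of_nat n)) (snd (of_nat n))). split; [split|].
  - intros p Hp. destruct (HD p Hp) as [i Hi]. destruct (HF i) as [[Hcov _] _].
    destruct (Hcov p Hi) as [j Hj]. exists (to_nat (i, j)). now rewrite cancel_of_to.
  - intros n. apply HF.
  - intros N. set (u := fun i j => phi (diam (F i j))).
    assert (Hu : forall i j, 0 <= u i j).
    { intros i j. apply Hphi. destruct (HF i) as [[_ Hd] _]. exact (diam_ge0 _ _ (Hd j)). }
    rewrite sum_f_R0_lsum.
    rewrite <- (lsum_map (fun ij => u (fst ij) (snd ij)) of_nat).
    (* Both coordinates of a pair are at most its code, so the first [N + 1] pairs lie in a square
       with [N + 1] indices per side. *)
    apply Rle_trans with (lsum (fun ij => u (fst ij) (snd ij))
      (list_prod (seq 0 (S N)) (seq 0 (S N)))).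
    + apply lsum_incl.
      * intros; apply Hu.
      * apply NoDup_map_NoDup_ForallPairs; [intros n n' _ _; apply of_nat_inj|apply seq_NoDup].
      * intros [i j] Hij. apply in_map_iff in Hij as (n & Hn & Hin). apply in_seq in Hin.
        pose proof (to_nat_non_decreasing i j) as H. rewrite <- Hn, cancel_to_of in H.
        apply in_prod; apply in_seq; lia.
    + rewrite lsum_list_prod. apply Rle_trans with (lsum v (seq 0 (S N))).
      * apply lsum_le. intros i _. rewrite <- sum_f_R0_lsum. apply HF.
      * rewrite <- sum_f_R0_lsum. apply Hc.
Qed.

Lemma small_cells phi delta (D : pt -> Prop) cov :
  inH phi -> 0 < delta -> (forall nc, In nc cov -> / 2 ^ fst nc < delta) ->
  (forall p, D p -> exists n, In (n, cell n p) cov) -> small phi delta D (cost phi cov).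
Proof.
  intros (Hphi0 & Hphi1 & Hphi & _) Hdel Hcov HD.
  (* Past the end of [cov] the cover continues with empty sets, of diameter 0 and cost
     [phi 0 = 0]. *)
  set (F := fun i p => match nth_error cov i with
                       | Some nc => cell (fst nc) p = snd nc | None => False end).
  set (v := fun i => match nth_error cov i with Some nc => phi (/ 2 ^ fst nc) | None => 0 end).
  assert (HF : forall i, diam_lt (F i) delta /\ phi (diam (F i)) <= v i).
  { intros i. unfold F, v. destruct (nth_error cov i) as [[n c]|] eqn:E; cbn [fst snd].
    - pose proof (inv2_pos n). pose proof (Hcov _ (nth_error_In _ _ E)) as Hn; cbn [fst] in Hn.
      destruct (diam_bound (fun p => cell n p = c) (/ 2 ^ n)) as [H1 H2]; [lra| |].
      { intros x y <- Hy. now apply cell_dist. }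
      split; [now apply H1|]. apply Hphi; [|exact H2].
      apply (diam_ge0 _ delta). now apply H1.
    - destruct (diam_bound (fun _ : pt => False) 0) as [H1 H2]; [lra|tauto|].
      split; [now apply H1|]. pose proof (diam_ge0 _ _ (H1 delta Hdel)).
      replace (diam (fun _ : pt => False)) with 0 by lra. lra. }
  exists F. split; [split|].
  - intros p Hp. destruct (HD p Hp) as [n Hn]. apply In_nth_error in Hn as [i Hi].
    exists i. unfold F. now rewrite Hi.
  - intros i. apply HF.
  - intros N. rewrite sum_f_R0_lsum. apply Rle_trans with (lsum v (seq 0 (S N))).
    { apply lsum_le. intros i _. apply HF. }
    generalize (S N) as M. unfold v, cost. clear -Hphi1.
    assert (Hpos : forall l, 0 <= lsum (fun nc : nat * (Z * Z) => phi (/ 2 ^ fst nc)) l).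
    { intros l. apply lsum_ge0. intros nc _. apply Hphi1. left. apply inv2_pos. }
    induction cov as [|nc cov IH]; intros M.
    + rewrite lsum_eq0; [simpl; lra|]. now intros [|i] _.
    + destruct M as [|M]; [apply (Hpos (nc :: cov))|].
      cbn [seq]. rewrite <- seq_shift. cbn [lsum fold_right]. apply Rplus_le_compat_l.
      fold (lsum (fun nc : nat * (Z * Z) => phi (/ 2 ^ fst nc)) cov).
      pose proof (lsum_map (fun i => match nth_error (nc :: cov) i with
        Some nc => phi (/ 2 ^ fst nc) | None => 0 end) S (seq 0 M)) as E.
      unfold lsum in E at 1. rewrite E. apply IH.
Qed.

Lemma small_mono phi delta (D D' : pt -> Prop) c c' :
  (forall p, D' p -> D p) -> c <= c' -> small phi delta D c -> small phi delta D' c'.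
Proof.
  intros HD Hc (F & [HF1 HF2] & HF). exists F. split; [split; auto|].
  intros N. specialize (HF N). lra.
Qed.

Lemma dyadic_scale k0 x : 0 < x -> x < / 2 ^ k0 ->
  exists j, / 2 ^ (k0 + S j) <= x < 2 * / 2 ^ (k0 + S j).
Proof.
  intros Hx Hk0. destruct (inv2_small x Hx) as [n Hn].
  assert (H : forall j, / 2 ^ (k0 + j) <= x ->
    exists j, / 2 ^ (k0 + S j) <= x < 2 * / 2 ^ (k0 + S j)).
  { induction j as [|j IH]; intros Hj; [rewrite Nat.add_0_r in Hj; lra|].
    destruct (Rle_lt_dec (/ 2 ^ (k0 + j)) x) as [H|H]; [auto|].
    exists j. split; [exact Hj|]. rewrite <- plus_n_Sm, inv2_S. lra. }
  apply (H n). pose proof (inv2_le n (k0 + n) ltac:(lia)). lra.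
Qed.

Lemma series_tail u l :
  Un_cv (fun N => sum_f_R0 u N) l ->
  exists n0, forall k, (n0 <= k)%nat -> forall N, sum_f_R0 (fun j => u (k + j)%nat) N <= 1.
Proof.
  intros H. destruct (H (1 / 2) ltac:(lra)) as [n0 Hn0]. exists (S n0). intros k Hk N.
  destruct k as [|k]; [lia|].
  assert (E : sum_f_R0 (fun j => u (S k + j)%nat) N = sum_f_R0 u (S k + N) - sum_f_R0 u k).
  { induction N as [|N IH].
    - rewrite Nat.add_0_r. simpl. rewrite Nat.add_0_r. lra.
    - rewrite <- plus_n_Sm. cbn [sum_f_R0]. rewrite IH, <- plus_n_Sm. lra. }
  rewrite E. pose proof (Hn0 (S k + N)%nat ltac:(lia)) as H1. pose proof (Hn0 k ltac:(lia)) as H2.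
  unfold Rdist in *. apply Rabs_def2 in H1, H2. lra.
Qed.

(* The sets [F i] are sorted by diameter and replaced, scale by scale, by the squares they meet:
   unlike the [F i], distinct squares do not overlap, so they can be counted along segments. *)
Lemma dyadic_squares h F k0 eta :
  inH h -> (forall j, 0 < h (/ 2 ^ (k0 + S j))) -> (forall i, diam_lt (F i) (/ 2 ^ k0)) ->
  (forall N, sum_f_R0 (fun i => h (diam (F i))) N <= eta) ->
  exists (QL : nat -> list (Z * Z)) (v : nat -> R),
    (forall j, NoDup (QL j)) /\
    (forall i p, F i p -> 0 < diam (F i) -> exists j, In (cell (k0 + S j) p) (QL j)) /\
    (forall j, INR (length (QL j)) * h (/ 2 ^ (k0 + S j)) <= 81 * v j) /\
    (forall N, sum_f_R0 v N <= eta).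
Proof.
  intros (_ & Hh0 & Hh & _) Hpos HF Hsum.
  set (u := fun i => h (diam (F i))).
  assert (Hu : forall i, 0 <= u i) by (intros i; apply Hh0; exact (diam_ge0 _ _ (HF i))).
  set (P := fun j i => / 2 ^ (k0 + S j) <= diam (F i) < 2 * / 2 ^ (k0 + S j)).
  assert (Hu2 : forall j i, P j i -> h (/ 2 ^ (k0 + S j)) <= u i).
  { intros j i [H1 _]. apply Hh; [left; apply inv2_pos|exact H1]. }
  (* Each set of scale [j] costs at least the positive [h (/ 2 ^ (k0 + S j))], so there are finitely
     many. *)
  assert (Hjl : forall j, exists l, NoDup l /\ forall i, In i l <-> P j i).
  { intros j. apply bounded_NoDup_list with (eta / h (/ 2 ^ (k0 + S j))). intros l Hl HP.
    specialize (Hpos j). apply Rmult_le_reg_r with (h (/ 2 ^ (k0 + S j))); [exact Hpos|].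
    replace (eta / h (/ 2 ^ (k0 + S j)) * h (/ 2 ^ (k0 + S j))) with eta by (field; lra).
    rewrite <- lsum_const. apply Rle_trans with (lsum u l).
    - apply lsum_le. auto.
    - now apply lsum_le_partial. }
  apply choice_fun in Hjl as [jl Hjl].
  destruct (choice_fun (fun i q => (exists p, F i p) -> F i q)) as [q Hq].
  { intros i. destruct (excluded_middle_informative (exists p, F i p)) as [[p Hp]|H];
      [now exists p|exists (0, 0); tauto]. }
  (* A set of scale [j] has diameter below [2 * / 2 ^ (k0 + S j)], four square sides, so it lies in
     the [9 ^ 2 = 81] squares around that of its point [q i]. *)
  set (bx := fun j i => box (cell (k0 + S j) (q i)) 4).
  set (dec := fun x y : Z * Z => excluded_middle_informative (x = y)).
  exists (fun j => nodup dec (flat_map (bx j) (jl j))), (fun j => lsum u (jl j)).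
  split; [intros; apply NoDup_nodup|]. split; [|split].
  - intros i p Hp Hd. destruct (diam_spec _ _ (HF i)) as [_ Hlt].
    destruct (dyadic_scale k0 _ Hd Hlt) as [j Hj]. exists j. apply nodup_In, in_flat_map.
    exists i. split; [now apply Hjl|]. apply cell_in_box.
    pose proof (dist2_le_diam _ _ p (q i) (HF i) Hp (Hq i (ex_intro _ p Hp))).
    pose proof (two_pow_gt0 (k0 + S j)).
    replace (INR 4) with (2 ^ S (k0 + S j) * (2 * / 2 ^ (k0 + S j)))
      by (simpl pow; simpl INR; field; simpl pow in *; lra).
    apply Rmult_le_compat_l; [left; apply two_pow_gt0|lra].
  - intros j. apply Rle_trans with (81 * (INR (length (jl j)) * h (/ 2 ^ (k0 + S j)))).
    + rewrite <- Rmult_assoc. apply Rmult_le_compat_r; [left; apply Hpos|].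
      replace 81 with (INR 81) by (simpl; lra). rewrite <- mult_INR. apply le_INR.
      rewrite <- (length_flat_map_const (bx j)) by (intros; apply box_length).
      apply NoDup_incl_length; [apply NoDup_nodup|]. intros c Hc. now apply nodup_In in Hc.
    + apply Rmult_le_compat_l; [lra|]. rewrite <- lsum_const. apply lsum_le.
      intros i Hi. apply Hu2. now apply Hjl.
  (* An index has only one scale, so the lists [jl j] are disjoint and no cost is counted twice. *)
  - intros N. rewrite sum_f_R0_lsum, <- lsum_flat_map. apply lsum_le_partial; auto.
    apply NoDup_flat_map_disjoint; [apply seq_NoDup|intros; apply Hjl|].
    intros j j' i Hi Hi'. apply Hjl in Hi as [H1 H2], Hi' as [H3 H4].
    assert (K : forall a b, / 2 ^ (k0 + S a) <= diam (F i) -> diam (F i) < 2 * / 2 ^ (k0 + S b) ->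
      ~ (a < b)%nat).
    { intros a b Ha Hb Hab. pose proof (inv2_le (k0 + S a) (k0 + b) ltac:(lia)).
      rewrite <- plus_n_Sm, inv2_S in Hb. lra. }
    pose proof (K j j' H1 H4). pose proof (K j' j H3 H2). lia.
Qed.

(** Otherwise the squares of [QL j] that [l] meets would have [hf]-cost at most [a j] for every [j],
    and together with the sets of diameter 0 they would cover the part of [E] on [l] at cost at most
    1. *)
Lemma rich_scale hf (E l : pt -> Prop) F k0 QL a :
  inH hf -> delta_cover (/ 2 ^ k0) E F -> (forall N, sum_f_R0 a N <= 1) ->
  (forall i p, F i p -> 0 < diam (F i) -> exists j, In (cell (k0 + S j) p) (QL j)) ->
  Hdelta_gt hf (/ 2 ^ k0) (fun p => l p /\ E p) 1 ->
  exists j, a j < hf (/ 2 ^ (k0 + S j)) * lsum (fun c => indic (meets (k0 + S j) l c)) (QL j).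
Proof.
  intros Hhf [HE HF] Ha HQ (eta & Heta & HH). apply NNPP. intros Hno.
  apply (not_small _ _ _ 1 eta Heta HH).
  pose proof (inv2_pos k0) as Hd.
  (* Piece [O] collects the sets of diameter 0, which have no dyadic scale but cost [hf 0 = 0];
     piece [S j] belongs to scale [j]. *)
  set (Di := fun n p => match n with
    | O => exists i, F i p /\ diam (F i) = 0
    | S j => l p /\ In (cell (k0 + S j) p) (QL j) end).
  apply small_subadd with (Di := Di) (v := fun n => match n with O => 0 | S j => a j end); auto.
  - intros [|j].
    + exists (fun i p => F i p /\ diam (F i) = 0).
      assert (H0 : forall i, (forall delta, 0 < delta -> diam_lt (fun p => F i p /\ diam (F i) = 0) delta)
        /\ diam (fun p => F i p /\ diam (F i) = 0) <= 0).
      { intros i. apply diam_bound; [lra|]. intros x y [Hx Hx0] [Hy _]. rewrite <- Hx0.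
        exact (dist2_le_diam _ _ x y (HF i) Hx Hy). }
      split; [split|].
      * intros p Hp. exact Hp.
      * intros i. now apply H0.
      * intros N. rewrite sum_f_R0_lsum, lsum_eq0; [lra|]. intros i _.
        destruct (H0 i) as [H1 H2]. pose proof (diam_ge0 _ _ (H1 _ Hd)).
        replace (diam _) with 0 by lra. apply Hhf.
    + set (fl := filter (fun c => if excluded_middle_informative (meets (k0 + S j) l c)
                                  then true else false) (QL j)).
      apply small_mono with (D := Di (S j)) (c := cost hf (map (fun c => (k0 + S j, c)%nat) fl)); auto.
      * unfold cost. rewrite lsum_map. cbn [fst]. rewrite lsum_const. unfold fl.
        rewrite <- lsum_indic_filter, Rmult_comm. apply Rnot_lt_le. intros H. apply Hno. now exists j.
      * apply small_cells; auto.
        -- intros nc Hnc. apply in_map_iff in Hnc as (c & <- & _). cbn [fst].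
           pose proof (inv2_le (S k0) (k0 + S j) ltac:(lia)). rewrite inv2_S in H. lra.
        -- intros p [Hp Hpc]. exists (k0 + S j)%nat. apply in_map, filter_In. split; [exact Hpc|].
           destruct excluded_middle_informative as [_|H]; [reflexivity|].
           exfalso. apply H. now exists p.
  - intros N. destruct N as [|N]; [simpl; lra|].
    enough (sum_f_R0 (fun n => match n with O => 0 | S j => a j end) (S N) = sum_f_R0 a N) as ->
      by apply Ha.
    induction N as [|N IH]; [simpl; lra|]. rewrite tech5, IH. reflexivity.
  - intros p [Hlp HEp]. destruct (HE p HEp) as [i Hi].
    pose proof (diam_ge0 _ _ (HF i)) as H0. destruct (Req_dec (diam (F i)) 0) as [H1|H1].
    + exists O. now exists i.
    + destruct (HQ i p Hi ltac:(lra)) as [j Hj]. exists (S j). now split.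
Qed.

(** * Summation over the scales and the theorem *)

Lemma sum_half_powers c N : 0 <= c -> sum_f_R0 (fun n => c * / 2 ^ S n) N <= c.
Proof.
  intros Hc.
  enough (sum_f_R0 (fun n => c * / 2 ^ S n) N = c - c * / 2 ^ S N) as ->.
  { pose proof (inv2_pos (S N)). nra. }
  induction N as [|N IH]; [simpl; field|]. rewrite tech5, IH, (inv2_S (S N)). field.
  apply pow_nonzero. lra.
Qed.

Theorem theorem3p1 (gf hf h : R -> R) (E : pt -> Prop) :
  inH gf -> inHd hf -> F_set hf gf E -> inH h ->
  sum_condition hf gf h ->
  Haus_gt h E 0.
Proof.
  intros Hgf [Hhf _] (L & HLc & (dL & HdL & etaL & HetaL & HL) & dE & HdE & Hseg) Hh
    (Hhpos & lim & Hlim).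
  assert (Hg0 : forall n, 0 <= gf (/ 2 ^ n)) by (intros; apply Hgf; left; apply inv2_pos).
  destruct (choice_fun (fun e (l : (pt -> Prop) * R) => L e ->
    (exists a, forall p, fst l p -> exists t, 0 <= t <= snd l /\ p = seg_pt a e t) /\
    forall delta, 0 < delta < dE -> Hdelta_gt hf delta (fun p => fst l p /\ E p) 1)) as [l Hl].
  { intros e. destruct (excluded_middle_informative (L e)) as [He|He].
    - destruct (Hseg e He) as (s & (a & len & _ & Hs) & Hd). exists (s, len). intros _.
      split; [|exact Hd]. exists a. intros p. apply Hs.
    - exists (fun _ => False, 0). tauto. }
  (* Segment lengths may be unbounded on [L], so [L] is split by length. If every piece had content
     at most [etaL / 2 * / 2 ^ S n], then [L] would have content at most [etaL / 2]. *)
  assert (Hm : exists m c, 1 <= m /\ 0 < c /\ ~ small gf dL (fun e => L e /\ snd (l e) <= m) c).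
  { apply NNPP. intros Hno. apply (not_small gf dL L (etaL / 2) etaL); [lra|exact HL|].
    apply small_subadd with (Di := fun m e => L e /\ snd (l e) <= INR (S m))
      (v := fun n => etaL / 2 * / 2 ^ S n); auto.
    - intros m. apply NNPP. intros Hm. apply Hno.
      exists (INR (S m)), (etaL / 2 * / 2 ^ S m). split; [|split; [|exact Hm]].
      + rewrite S_INR. pose proof (pos_INR m). lra.
      + apply Rmult_lt_0_compat; [lra|apply inv2_pos].
    - intros N. apply sum_half_powers. lra.
    - intros e He. destruct (INR_unbounded (snd (l e))) as [m Hm]. exists m.
      rewrite S_INR. split; [exact He|lra]. }
  destruct Hm as (m & c & Hm1 & Hc & Hsm).
  set (Lm := fun e => L e /\ snd (l e) <= m) in *.
  (* The successor ensures [1 <= n0], as [Gsum_le_Cint] requires. *)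
  destruct (inv2_small dL HdL) as [n0' Hn0']. set (n0 := S n0').
  assert (Hn0 : / 2 ^ n0 < dL) by (pose proof (inv2_le n0' n0 ltac:(lia)); lra).
  destruct (inv2_small dE HdE) as [n1 Hn1].
  apply series_tail in Hlim as [n2 Hn2].
  set (k0 := (n0 + n1 + n2)%nat).
  set (aa := fun j => sqrt (hf (/ 2 ^ (k0 + S j)) ^ 2 * Cint gf (/ 2 ^ (k0 + S j))
    / h (/ 2 ^ (k0 + S j)))).
  assert (Haa : forall N, sum_f_R0 aa N <= 1).
  { intros N. specialize (Hn2 k0 ltac:(lia) N). cbv zeta in Hn2.
    erewrite sum_eq; [exact Hn2|]. intros j _. unfold aa. now rewrite plus_n_Sm. }
  set (r := INR (length (roots n0))). assert (Hr : 0 <= r) by apply pos_INR.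
  set (A := 45 * m * (r + 196)). assert (HA : 0 < A) by (unfold A; nra).
  exists (/ 2 ^ k0). split; [apply inv2_pos|].
  (* [324 = 4 * 81], with 4 from [Gsum_le_Cint] and 81 from [dyadic_squares]; [A] is the constant of
     [incidence_bound]. *)
  exists (c / (324 * A)). split; [apply Rdiv_lt_0_compat; lra|].
  intros F HF t Ht. apply NNPP. intros Hno.
  assert (Hsum : forall N, sum_f_R0 (fun i => h (diam (F i))) N <= c / (324 * A)).
  { intros N. apply Rle_trans with t; [|lra]. apply Rnot_lt_le. intros H. apply Hno. now exists N. }
  assert (Hhk : forall j, 0 < h (/ 2 ^ (k0 + S j))) by (intros; apply Hhpos; lia).
  destruct (dyadic_squares h F k0 _ Hh Hhk (proj2 HF) Hsum) as (QL & v & HQnd & HQ & HQv & Hv).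
  assert (Hv0 : forall j, 0 <= v j).
  { intros j. specialize (HQv j). pose proof (pos_INR (length (QL j))). specialize (Hhk j). nra. }
  (* Piece [j] holds the directions whose segments are rich at scale [k0 + S j]. The contents add up
     to at most [c], which contradicts the choice of [c]. *)
  apply Hsm. apply small_subadd with
    (Di := fun j e => Lm e /\ aa j < hf (/ 2 ^ (k0 + S j)) *
       lsum (fun c => indic (meets (k0 + S j) (fst (l e)) c)) (QL j))
    (v := fun j => 324 * A * v j); auto.
  - intros j. set (k := (k0 + S j)%nat). pose proof (HQv j) as HQj. pose proof (Hhk j) as Hhj.
    fold k in HQj, Hhj.
    assert (Hhf0 : 0 <= hf (/ 2 ^ k)) by (apply Hhf; left; apply inv2_pos).
    destruct Hhf0 as [Hhf0|Hhf0].
    (* If [hf] vanishes at this scale, the strict inequality fails and the piece is empty. *)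
    2:{ apply small_mono with (D := fun _ => False) (c := cost gf []).
        - intros e [_ He]. rewrite <- Hhf0, Rmult_0_l in He. pose proof (sqrt_pos
            (hf (/ 2 ^ k) ^ 2 * Cint gf (/ 2 ^ k) / h (/ 2 ^ k))). unfold aa in He. fold k in He. lra.
        - unfold cost; simpl. specialize (Hv0 j). nra.
        - apply small_cells; auto; simpl; tauto. }
    assert (Hk : k = (n0 + (k - n0))%nat) by lia. set (d := (k - n0)%nat) in *.
    pose proof (Gsum_le_Cint gf n0 d Hgf ltac:(lia)) as HG. rewrite <- Hk in HG.
    assert (HG0 : 0 <= Gsum gf n0 d).
    { apply lsum_ge0. intros n _. apply Rmult_le_pos; [left; apply two_pow_gt0|apply Hg0]. }
    set (G := Gsum gf n0 d) in *. set (I := Cint gf (/ 2 ^ k)) in *.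
    destruct (incidence_bound gf (fun e => Lm e /\ aa j < hf (/ 2 ^ k) *
       lsum (fun c => indic (meets k (fst (l e)) c)) (QL j)) n0 d m (QL j) (aa j / hf (/ 2 ^ k))
       (fun e => fst (l e))) as (cov & Hcov1 & Hcov2 & Hcost1 & Hcost2); auto.
    { intros e [[He Hlen] _]. split; [auto|]. destruct (Hl e He) as [(a & Ha) _].
      exists a, (snd (l e)). auto. }
    { apply Rdiv_le_0_compat; [apply sqrt_pos|exact Hhf0]. }
    { intros e [_ He]. rewrite <- Hk. left. apply Rmult_lt_reg_r with (hf (/ 2 ^ k)); [exact Hhf0|].
      unfold Rdiv. rewrite Rmult_assoc, Rinv_l by lra. lra. }
    fold r A G in Hcost1, Hcost2.
    apply small_mono with (D := fun e => Lm e /\ aa j < hf (/ 2 ^ k) *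
       lsum (fun c => indic (meets k (fst (l e)) c)) (QL j)) (c := cost gf cov); auto.
    (* The division by [hf (/ 2 ^ k)] cancels the factor [hf ^ 2] under the root. *)
    + assert (Ht2 : (aa j / hf (/ 2 ^ k)) ^ 2 = I / h (/ 2 ^ k)).
      { unfold Rdiv at 1. unfold aa. fold k. fold I.
        rewrite Rpow_mult_distr, pow2_sqrt.
        - field. lra.
        - apply Rdiv_le_0_compat; [|exact Hhj]. apply Rmult_le_pos; [apply pow2_ge_0|lra]. }
      rewrite Ht2 in Hcost2. specialize (Hv0 j).
      (* If [I = 0] then [G = 0], and the first cost bound is enough. *)
      assert (HI : 0 <= I) by lra. destruct HI as [HI|HI]; [|nra].
      apply Rmult_le_reg_r with (I / h (/ 2 ^ k)); [now apply Rdiv_lt_0_compat|].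
      apply Rle_trans with (1 := Hcost2).
      pose proof (pos_INR (length (QL j))).
      apply Rle_trans with (A * INR (length (QL j)) * (4 * I)).
      { apply Rmult_le_compat_l; [nra|exact HG]. }
      apply Rle_trans with (4 * A * (I / h (/ 2 ^ k)) * (INR (length (QL j)) * h (/ 2 ^ k))).
      { right. field. lra. }
      apply Rle_trans with (4 * A * (I / h (/ 2 ^ k)) * (81 * v j)); [|right; ring].
      apply Rmult_le_compat_l; [|exact HQj].
      apply Rmult_le_pos; [lra|]. left. now apply Rdiv_lt_0_compat.
    + apply small_cells; auto. intros nc Hnc. specialize (Hcov1 nc Hnc).
      pose proof (inv2_le n0 (fst nc) ltac:(lia)). lra.
  - intros N. rewrite sum_f_R0_lsum, lsum_scal, <- sum_f_R0_lsum.
    apply Rle_trans with (324 * A * (c / (324 * A))).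
    + apply Rmult_le_compat_l; [lra|apply Hv].
    + right. field. lra.
  - intros e He. destruct (Hl e (proj1 He)) as [_ Hgt].
    destruct (rich_scale hf E (fst (l e)) F k0 QL aa) as [j Hj]; auto.
    + apply Hgt. split; [apply inv2_pos|].
      pose proof (inv2_le n1 k0 ltac:(lia)). lra.
    + now exists j.
Qed.
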